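(* Let $\xi>0$ be a constant and $\delta=\xi m$. In the base model $G_n$, let $r=n^{-1/2+\epsilon}$, where $\epsilon>0$, and $m\ge K\ln n$ for some sufficiently large constant $K$. 1. If $R=n^{-1/2+\rho}$, for any $\rho>\epsilon$, then with high probability, for every $v\in V_n$, $|C_R(v)|=\Theta(n^{2\rho})$ and $\Phi(C_R(v))=O\!\left(\frac1{n^{\rho-\epsilon}}\right)$. 2. With high probability, for all $R=o(r)$ and every $v\in V_n$, $\Phi(C_R(v))=\Omega(1)$.
   Context: ''With high probability'' means with probability $1-o(1)$ as $n\to\infty$, where $n$ is the number of vertices generated; the parameters $m$ (a positive integer), $r$ and $\delta$ may depend on $n$. Let $S$ be a sphere of unit area (radius $\frac1{2\sqrt\pi}$), $\|\cdot\|$ the angular distance on $S$, and $B_R(v)=\{u\in S:\|u-v\|\le R\}$. A self-loop counts as degree $1$. All graphs are multigraphs; $V_t=\{x_1,\dots,x_t\}$ is the vertex set at time $t$. The $R$-neighborhood of $v\in V_n$ is $C_R(v)=B_R(v)\cap V_n$, the set of all vertices of $G_n$ within distance at most $R$ from $v$. In a graph $G=(V,E)$, $\mathrm{vol}(A)=\sum_{v\in A}\deg_G(v)$ for $A\subseteq V$, and the conductance of $A$ is $\Phi(A)=\frac{|e(A,\bar A)|}{\min\{\mathrm{vol}(A),\mathrm{vol}(\bar A)\}}$, where $\bar A=V\setminus A$ and $e(A,\bar A)$ is the set of edges with one endpoint in $A$ and the other in $\bar A$. Base model. $G_1$ consists of a uniformly random point $x_1\in S$ with $2m$ self-loops. At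 time $t+1$ ($t\ge1$), a new vertex $x_{t+1}$ is drawn uniformly at random from $S$. If $B_r(x_{t+1})\cap V_t=\emptyset$, then $2m$ self-loops are added to $x_{t+1}$. Otherwise $m$ contacts $y_1^{t+1},\dots,y_m^{t+1}$ are chosen independently (with replacement) from $B_r(x_{t+1})\cap V_t$, with $$\Pr[y_i^{t+1}=v]=\frac{\deg_t(v)+\delta}{\sum_{w\in B_r(x_{t+1})\cap V_t}(\deg_t(w)+\delta)},$$ where $\deg_t(v)$ is the degree of $v$ in $G_t$, and the edges $(x_{t+1},y_i^{t+1})$ are added.
   Formalization: Part 1 is stated for ε<ρ≤1/2, since for ρ>1/2 the claim |C_R(v)|=Θ(n^{2ρ}) is impossible (|C_R(v)|≤n) and C_R(v)=V_n has undefined conductance; part 2 excludes the case C_R(v)=V_n, where the conductance is 0/0. *)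

(* Defs.v *)
From HB Require Import structures.
From mathcomp Require Import all_boot all_order all_algebra.
From mathcomp Require Import all_classical all_reals all_analysis.
Set Implicit Arguments.
Unset Strict Implicit.
Unset Printing Implicit Defensive.
Import Order.TTheory GRing.Theory Num.Theory.
Import numFieldNormedType.Exports.
Local Open Scope classical_set_scope.
Local Open Scope ring_scope.

Definition vec3 (R : realType) := (R * R * R)%type.

Definition dot (R : realType) (u v : vec3 R) : R :=
  u.1.1 * v.1.1 + u.1.2 * v.1.2 + u.2 * v.2.

Definition radius (R : realType) : R := (2 * Num.sqrt pi)^-1.

Definition sphere (R : realType) : set (vec3 R) :=
  [set u | dot u u = radius R ^+ 2].

(* The angle, in [0, pi], between two points of the sphere seen from its
   centre. *)
Definition angle (R : realType) (u v : vec3 R) : R :=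
  acos (dot u v / radius R ^+ 2).

(* Spherical coordinates: a.1 is the polar angle in [0, pi] and a.2 the
   azimuth in [0, 2 pi]. *)
Definition sphere_point (R : realType) (a : R * R) : vec3 R :=
  (radius R * (sin a.1 * cos a.2), radius R * (sin a.1 * sin a.2),
   radius R * cos a.1).

(* Surface area of the part of B lying on the sphere; radius ^+ 2 * sin is the
   Jacobian of the spherical coordinates.  The sphere has area 1, so this is
   also the uniform probability distribution on it. *)
Definition area (R : realType) (B : set (vec3 R)) : \bar R :=
  (\int[lebesgue_measure \x lebesgue_measure]_(a in (`[0, pi] `*` `[0, 2 * pi])%R)
    (radius R ^+ 2 * sin a.1 * \1_B (sphere_point a))%:E)%E.

(* A multigraph with vertex type V is the list of its edges, loops and
   repetitions allowed.  The orientation of an edge is irrelevant. *)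
Definition multigraph (V : finType) := seq (V * V).

(* A loop contributes 1. *)
Definition deg (V : finType) (G : multigraph V) (v : V) : nat :=
  count (fun e => (e.1 == v) || (e.2 == v)) G.

Definition vol (V : finType) (G : multigraph V) (A : {set V}) : nat :=
  (\sum_(v in A) deg G v)%N.

Definition cut (V : finType) (G : multigraph V) (A : {set V}) : nat :=
  count (fun e => (e.1 \in A) (+) (e.2 \in A)) G.

(* Only meaningful when vol A and vol (~: A) are positive; it is 0 otherwise. *)
Definition conductance (R : realType) (V : finType) (G : multigraph V)
    (A : {set V}) : R :=
  (cut G A)%:R / (minn (vol G A) (vol G (~: A)))%:R.

(* The n vertices are numbered 0, ..., n - 1 in order of arrival, so that the
   vertex set V_t is {i | i < t}; vertex j is drawn at position [pos j] and, if
   some earlier vertex is within distance r, it is linked to its m contacts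
   [con j 0], ..., [con j (m - 1)]. *)

Definition ball_vertices (R : realType) (n : nat) (pos : 'I_n -> vec3 R)
    (r : R) (u : vec3 R) (t : nat) : {set 'I_n} :=
  [set i : 'I_n | (i < t)%N && (angle (pos i) u <= r)].

Definition new_edges (R : realType) (n m : nat) (r : R) (pos : 'I_n -> vec3 R)
    (con : 'I_n -> 'I_m -> 'I_n) (j : 'I_n) : multigraph 'I_n :=
  if ball_vertices pos r (pos j) j == finset.set0 then nseq (2 * m)%N (j, j)
  else [seq (j, con j i) | i <- enum 'I_m].

(* Since V_0 is empty, vertex 0 gets 2 m loops, as G_1 requires. *)
Definition graph_at (R : realType) (n m : nat) (r : R) (pos : 'I_n -> vec3 R)
    (con : 'I_n -> 'I_m -> 'I_n) (t : nat) : multigraph 'I_n :=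
  flatten [seq new_edges r pos con j | j : 'I_n <- enum 'I_n & (j < t)%N].

(* The probability that vertex j picks v as a given contact, when vertices
   0, ..., j - 1 have formed the graph G_j. *)
Definition contact_prob (R : realType) (n m : nat) (r delta : R)
    (pos : 'I_n -> vec3 R) (con : 'I_n -> 'I_m -> 'I_n) (j v : 'I_n) : R :=
  let G := graph_at r pos con j in
  let near := ball_vertices pos r (pos j) j in
  if v \in near then
    ((deg G v)%:R + delta) / \sum_(w in near) ((deg G w)%:R + delta)
  else 0.

(* The sigma-algebra generated by the positions of the vertices k with kx k and
   the contacts of the vertices k with kc k. *)
Definition history (R : realType) (n m : nat) (T : Type)
    (pos : 'I_n -> T -> vec3 R) (con : 'I_n -> 'I_m -> T -> 'I_n)
    (kx kc : pred 'I_n) : set (set T) :=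
  <<s [set A | (exists k, kx k /\
                 exists B : set (vec3 R), measurable B /\ A = pos k @^-1` B)
            \/ (exists k, kc k /\
                 exists i v, A = con k i @^-1` [set v])] >>.

(* A realisation, on some probability space, of the base model run up to
   time n. *)
Record base_model (R : realType) (n m : nat) (r delta : R) := BaseModel {
  bm_display : measure_display;
  bm_space : measurableType bm_display;
  bm_prob : probability bm_space R;
  bm_pos : 'I_n -> bm_space -> vec3 R;
  bm_con : 'I_n -> 'I_m -> bm_space -> 'I_n;
  bm_pos_measurable : forall j, measurable_fun setT (bm_pos j);
  bm_con_measurable : forall j i v, measurable (bm_con j i @^-1` [set v]);
  bm_pos_sphere : forall j w, sphere (bm_pos j w);
  (* the j-th position is uniform and independent of the past *)
  bm_pos_law : forall (j : 'I_n) (A : set bm_space) (B : set (vec3 R)),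
    history bm_pos bm_con (fun k => k < j)%N (fun k => k < j)%N A ->
    measurable B ->
    bm_prob (A `&` bm_pos j @^-1` B) = (bm_prob A * area B)%E;
  (* conditionally on the past and on its own position, the contacts of a
     non-isolated vertex j are independent with law contact_prob *)
  bm_con_law : forall (j : 'I_n) (A : set bm_space) (c : 'I_m -> 'I_n),
    history bm_pos bm_con (fun k => k <= j)%N (fun k => k < j)%N A ->
    (forall w, A w -> ball_vertices (bm_pos^~ w) r (bm_pos j w) j != finset.set0) ->
    bm_prob (A `&` [set w | forall i, bm_con j i w = c i]) =
    (\int[bm_prob]_(w in A)
      (\prod_(i < m)
         contact_prob r delta (bm_pos^~ w) (fun k l => bm_con k l w) j (c i))%:E)%E
}.

Section Realisation.
Context (R : realType) (n m : nat) (r delta : R) (M : base_model n m r delta).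

Definition final_graph (w : bm_space M) : multigraph 'I_n :=
  graph_at r ((@bm_pos _ _ _ _ _ M)^~ w) (fun k l => bm_con k l w) n.

Definition neighborhood (rho : R) (v : 'I_n) (w : bm_space M) : {set 'I_n} :=
  ball_vertices ((@bm_pos _ _ _ _ _ M)^~ w) rho (bm_pos v w) n.

End Realisation.

(* The events E n contain measurable events of probability 1 - o(1). *)
Definition whp (R : realType) (m : nat -> nat) (r delta : nat -> R)
    (M : forall n, base_model n (m n) (r n) (delta n))
    (E : forall n, set (bm_space (M n))) : Prop :=
  exists A : forall n, set (bm_space (M n)),
    [/\ forall n, measurable (A n), forall n, A n `<=` E n &
        bm_prob (M n) (A n) @[n --> \oo] --> 1%E].

(* Main.v *)
(* Large balls.  Almost surely all edges have length at most r, so an edge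
   leaving the ball of radius R about v starts in the annulus of width O(r) around its boundary,
   and that annulus is covered by O(R / r) caps of radius O(r).  Chernoff bounds,
   uniform over the caps centred at a polynomial number of grid points, show
   that caps of radius a contain of the order of n a^2 vertices.  Each vertex is
   the source of between m and 2 m edges, so the cut has O(m n R r) edges while
   both sides have volume at least of order m n R^2.

   Small balls.  A vertex is the source of at most 2 m edges, hence
   vol A <= 4 m |A| + cut A and it suffices that cut A >= c m |A|.  Take a cap T
   of radius r / 100 at distance about r / 2 from A: it contains at least of the
   order of n r^2 vertices, each of weight at least m, whereas the weights within
   reach of a given vertex add up to O(m n r^2).  So each vertex of A that
   arrived in the second half of the process sends a constant fraction of its m
   edges to T, and each earlier vertex of A receives at least c m edges from the
   late vertices of T.  Since m >= K ln n, both statements hold with high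
   probability simultaneously for all vertices and all grid caps T, and no union
   bound over the sets A is needed.  If eps > 1/2, distances do not matter and T
   is a small cap disjoint from A or from its complement. *)
Require Import Defs.
From mathcomp Require Import all_boot all_order all_algebra.
From mathcomp Require Import all_classical all_reals all_analysis.
From mathcomp Require Import measurable_realfun ring lra zify.
Set Implicit Arguments.
Unset Strict Implicit.
Unset Printing Implicit Defensive.
Import Order.TTheory GRing.Theory Num.Theory.
Import numFieldNormedType.Exports.
Local Open Scope classical_set_scope.
Local Open Scope ring_scope.

(** * Trigonometric inequalities *)

Section Trigonometry.
Context {R : realType}.
Implicit Types x y a b : R.

(** Contact probabilities depend on degrees, hence on all earlier choices, so the contacts form no
    independent family. Their tail bounds come from an exponential supermartingale ([adaptive_tail])
    in which a step scores only if a guard, decided before its contacts are drawn, says that its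
    target is hit with probability at least q. Such a bound is unconditional; on a good realisation
    the guards are verified afterwards by a deterministic argument. A single degree has no useful
    upper bound; only the total weight within reach is controlled, because edges of length at most r
    touching a ball of radius r have their sources in the ball of radius 2r. As (m + delta) / (4m +
    delta) >= 1/4, each neighbour is then a given contact with probability at least 1 / (4N), where
    N bounds the number of vertices in the larger ball. Early vertices are counted through the edges
    they receive, because the cap may still be almost empty when they arrive. The first half of the
    process fills the cap with targets, the second half fills it with sources. Conditioning reduces
    to finite sums by replacing positions with the finitely many neighbour sets they determine
    ([past]). *)

Lemma sin_le x : 0 <= x -> sin x <= x.
Proof.
move=> x0; rewrite -subr_ge0.
have D (y : R) : is_derive y 1 (fun y : R => y - sin y) (1 - cos y).
  by apply: is_deriveB.
have -> : 0 = (fun y : R => y - sin y) 0 by rewrite /= sin0 subr0.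
apply: (@ger0_derive1_ndecry _ (fun y => y - sin y) 0) => //.
- move=> y _; rewrite derive1E (derive_val (is_derive := D y)).
  by rewrite subr_ge0 cos_le1.
- apply: derivable_within_continuous => y _; exact: ex_derive.
Qed.

Lemma cos_double x : cos x = 1 - 2 * sin (x / 2) ^+ 2.
Proof.
rewrite {1}(_ : x = (x / 2) *+ 2); last by rewrite mulr2n; lra.
by rewrite cos_mulr2n cos2sin2 mulr2n; lra.
Qed.

Lemma cos_ge x : 1 - x ^+ 2 / 2 <= cos x.
Proof.
rewrite -cos_norm -(real_normK (num_real x)); move: (normr_ge0 x).
move: `|x| => {}x x0.
have s := @sin_le (x / 2) ltac:(lra).
have [s0|s0] := leP 0 (sin (x / 2)); rewrite cos_double; first by nra.
have : -1 <= sin (x / 2) by exact: sin_geN1.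
have [x2|x2] := leP 2 x; first by nra.
by have := @sin_ge0_pi _ (x/2) ltac:(have := @pi_ge2 R; lra); lra.
Qed.

Lemma sin_ge_cubic x : 0 <= x -> x - x ^+ 3 / 6 <= sin x.
Proof.
move=> x0; rewrite -subr_ge0.
have E : 0 = (fun y : R => sin y - (y - y ^+ 3 / 6)) 0 by rewrite /= sin0 expr0n/=; lra.
rewrite E.
have D (y : R) : is_derive y 1 (fun y : R => sin y - (y - y ^+ 3 / 6)) (cos y - (1 - y ^+ 2 / 2)).
  apply: is_deriveB; apply: is_deriveB.
  have -> : y ^+ 2 / 2 = 6^-1 * (3 * y ^+ 2) by lra.
  rewrite (_ : (fun _ => _) = (fun y : R => 6^-1 *: (y ^+ 3))); last first.
    by apply/funext => z; rewrite mulrC.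
  apply: is_deriveZ.
  have := @is_deriveX _ _ id 3 y 1 1 (@is_derive_id _ _ _ _).
  rewrite (_ : id ^+ 3 = (fun z : R => z ^+ 3)); last exact/funext.
  by rewrite -mulr_algl mulr1 scaler1.
apply: (@ger0_derive1_ndecry _ (fun y => sin y - (y - y ^+ 3 / 6)) 0) => //.
- move=> y _; rewrite derive1E (derive_val (is_derive := D y)).
  by rewrite subr_ge0 cos_ge.
- apply: derivable_within_continuous => y _; exact: ex_derive.
Qed.

(** The slope 1/3 is 1 - 2^2 / 6; the range up to 2 covers all half-angles, since pi / 2 < 2. *)
Lemma sin_ge_third x : 0 <= x <= 2 -> x / 3 <= sin x.
Proof.
move=> /andP[x0 x2]; have := @sin_ge_cubic x x0.
have -> : x ^+ 3 = x * x ^+ 2 by rewrite exprS.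
have : x ^+ 2 <= 4 by nra.
by nra.
Qed.

Lemma pi_lt4 : pi < 4 :> R.
Proof. by have := @pihalf_lt2 R; lra. Qed.

(** By the half-angle formula, with sin (x / 2) >= x / 6 for x >= 0: 2 (x / 6)^2 = x^2 / 18. *)
Lemma cos_le x : `|x| <= pi -> cos x <= 1 - x ^+ 2 / 18.
Proof.
rewrite -cos_norm -(real_normK (num_real x)); move: (normr_ge0 x).
move: `|x| => {}x x0 xp; have p4 := pi_lt4.
have s := @sin_ge_third (x / 2) ltac:(lra).
by rewrite cos_double; nra.
Qed.

End Trigonometry.

(** * Geometry of the sphere *)

Definition cosine (R : realType) (u v : vec3 R) : R := dot u v / Defs.radius R ^+ 2.

Section SphereGeometry.
Context {R : realType}.
Implicit Types (u v w : vec3 R) (a b c : R).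

Lemma radius_gt0 : 0 < Defs.radius R.
Proof. by rewrite invr_gt0 mulr_gt0// sqrtr_gt0 pi_gt0. Qed.

Lemma dotC u v : dot u v = dot v u.
Proof. by rewrite /dot; ring. Qed.

Lemma angleC u v : angle u v = angle v u.
Proof. by rewrite /angle dotC. Qed.

Lemma cosine_diag v : sphere v -> cosine v v = 1.
Proof.
by rewrite /sphere/= /cosine => ->; rewrite divff// expf_neq0// gt_eqF// radius_gt0.
Qed.

(* The Gram determinant of three unit vectors. *)
Lemma gram_ge0 u v w : sphere u -> sphere v -> sphere w ->
  let x := cosine u v in let y := cosine v w in let z := cosine u w in
  0 <= 1 - x ^+ 2 - y ^+ 2 - z ^+ 2 + 2 * x * y * z.
Proof.
move=> su sv sw /=; rewrite /cosine.
have r0 : Defs.radius R ^+ 2 != 0 by rewrite expf_neq0// gt_eqF// radius_gt0.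
set r2 := Defs.radius R ^+ 2 in su sv sw r0 *.
have r3 : 0 < r2 ^+ 3 by rewrite !exprn_gt0// radius_gt0.
rewrite -(@pmulr_rge0 _ (r2 ^+ 3))//.
set E := (X in 0 <= X).
have -> : E = dot u u * dot v v * dot w w - dot u u * dot v w ^+ 2
    - dot v v * dot u w ^+ 2 - dot w w * dot u v ^+ 2
    + 2 * dot u v * dot v w * dot u w.
  rewrite /E (su : _ = r2) (sv : _ = r2) (sw : _ = r2).
  by field.
rewrite /dot; clear E su sv sw; move: u v w => [[u1 u2] u3] [[v1 v2] v3] [[w1 w2] w3] /=.
set F := (X in 0 <= X).
(* The Gram determinant is the square of the triple product of the three vectors. *)
have -> : F = (u1 * (v2 * w3 - v3 * w2) - u2 * (v1 * w3 - v3 * w1)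
   + u3 * (v1 * w2 - v2 * w1)) ^+ 2 by rewrite /F; ring.
exact: sqr_ge0.
Qed.

Lemma cosine_itv u v : sphere u -> sphere v -> -1 <= cosine u v <= 1.
Proof.
move=> su sv; suff : cosine u v ^+ 2 <= 1 by nra.
have r0 : Defs.radius R ^+ 2 != 0 by rewrite expf_neq0// gt_eqF// radius_gt0.
have r2 : 0 < Defs.radius R ^+ 2 by rewrite exprn_gt0// radius_gt0.
have r4 : 0 < Defs.radius R ^+ 2 ^+ 2 by rewrite exprn_gt0.
rewrite /cosine expr_div_n ler_pdivrMr// mul1r.
rewrite [X in _ <= X]expr2 -{1}su -sv /dot.
clear su sv; move: u v => [[u1 u2] u3] [[v1 v2] v3] /=.
rewrite -subr_ge0; set F := (X in 0 <= X).
(* Lagrange's identity: the deficit in the Cauchy-Schwarz inequality is the squared length of the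
   cross product. *)
have -> : F = (u1 * v2 - u2 * v1) ^+ 2 + (u1 * v3 - u3 * v1) ^+ 2
   + (u2 * v3 - u3 * v2) ^+ 2 by rewrite /F; ring.
by rewrite !addr_ge0// sqr_ge0.
Qed.

Lemma cos_angle u v : sphere u -> sphere v -> cos (angle u v) = cosine u v.
Proof. by move=> su sv; rewrite acosK// in_itv/=; exact: cosine_itv. Qed.

Lemma angle_ge0 u v : sphere u -> sphere v -> 0 <= angle u v.
Proof. by move=> su sv; apply: acos_ge0; exact: cosine_itv. Qed.

Lemma angle_lepi u v : sphere u -> sphere v -> angle u v <= pi.
Proof. by move=> su sv; apply: acos_lepi; exact: cosine_itv. Qed.

Lemma angle_diag v : sphere v -> angle v v = 0.
Proof. by move=> sv; rewrite /angle -/(cosine v v) cosine_diag// acos1. Qed.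

Lemma ler_cos a b : 0 <= a <= pi -> 0 <= b <= pi -> (cos a <= cos b) = (b <= a).
Proof.
by move=> a0 b0; rewrite !leNgt ltr_cos ?in_itv/=.
Qed.

Lemma angle_le_cos u v c : sphere u -> sphere v -> 0 <= c <= pi ->
  (angle u v <= c) = (cos c <= cosine u v).
Proof.
move=> su sv c0; rewrite -cos_angle// ler_cos//.
by rewrite angle_ge0// angle_lepi.
Qed.

(** With x, y, z the cosines of the sides uv, vw, uw, the Gram inequality rearranges to (xy - z)^2
    <= (1 - x^2)(1 - y^2). Hence z >= xy - sin sin, which is the cosine of the sum of the two
    angles. A sum of at least pi is trivial. *)
Lemma angle_triangle u v w : sphere u -> sphere v -> sphere w ->
  angle u w <= angle u v + angle v w.
Proof.
move=> su sv sw.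
have [pab|abp] := leP pi (angle u v + angle v w).
  exact: le_trans (angle_lepi su sw) pab.
have a0 := angle_ge0 su sv; have b0 := angle_ge0 sv sw.
rewrite angle_le_cos//; last by rewrite addr_ge0//= ltW.
have := gram_ge0 su sv sw; rewrite /= cosD !cos_angle//.
have := sin2cos2 (angle u v); have := sin2cos2 (angle v w).
rewrite !cos_angle//.
have := @sin_ge0_pi _ (angle u v) ltac:(rewrite a0/= angle_lepi//).
have := @sin_ge0_pi _ (angle v w) ltac:(rewrite b0/= angle_lepi//).
move: (sin _) (sin _) (cosine u v) (cosine v w) (cosine u w).
move=> s t x y z t0 s0 tE sE g.
have st0 : 0 <= s * t by rewrite mulr_ge0.
have stE : (s * t) ^+ 2 = (1 - x ^+ 2) * (1 - y ^+ 2) by rewrite exprMn sE tE.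
have h : (x * y - z) ^+ 2 <= (s * t) ^+ 2 by rewrite stE; nra.
suff : x * y - z <= s * t by lra.
have [q0|q0] := leP (x * y - z) 0; first exact: le_trans q0 st0.
by move: h; rewrite !expr2 => h; rewrite leNgt; apply/negP => ?; nra.
Qed.

Lemma sphere_sphere_point (p : R * R) : sphere (sphere_point p).
Proof.
rewrite /sphere/= /dot /sphere_point /=.
set r := Defs.radius R; have := cos2Dsin2 p.1; have := cos2Dsin2 p.2.
set c := cos p.1; set s := sin p.1; set c' := cos p.2; set s' := sin p.2.
move=> h' h.
transitivity (r ^+ 2 * (s ^+ 2 * (c' ^+ 2 + s' ^+ 2) + c ^+ 2)); first by ring.
by rewrite h' mulr1 addrC h mulr1.
Qed.

(** This form of the spherical law of cosines separates a polar term from an azimuthal loss of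
    constant sign, so that each can be compared with a square on its own. *)
Lemma cosine_sphere_point a b a' b' :
  cosine (sphere_point (a, b)) (sphere_point (a', b')) =
  cos (a - a') - sin a * sin a' * (1 - cos (b - b')).
Proof.
rewrite /cosine /sphere_point /dot/= !cosB; field.
by rewrite gt_eqF// radius_gt0.
Qed.

Lemma polar (x y : R) : exists t b,
  [/\ 0 <= t, 0 <= b <= 2 * pi, x = t * cos b & y = t * sin b].
Proof.
pose t := Num.sqrt (x ^+ 2 + y ^+ 2).
have t0 : 0 <= t by exact: sqrtr_ge0.
have tE : t ^+ 2 = x ^+ 2 + y ^+ 2 by rewrite sqr_sqrtr// addr_ge0// sqr_ge0.
have p0 := @pi_ge0 R.
have [tz|tn] := eqVneq t 0.
  exists 0, 0; split; rewrite ?lexx//; first by rewrite mulr_ge0.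
    by rewrite mul0r; rewrite tz expr0n/= in tE; nra.
  by rewrite mul0r; rewrite tz expr0n/= in tE; nra.
have tp : 0 < t by rewrite lt_neqAle eq_sym tn.
have xt : -1 <= x / t <= 1.
  by apply/andP; split; [rewrite ler_pdivlMr//|rewrite ler_pdivrMr//]; nra.
have cb : cos (acos (x / t)) = x / t by rewrite acosK.
have sb : sin (acos (x / t)) = `|y| / t.
  rewrite sin_acos// expr_div_n (_ : 1 - _ = (y / t) ^+ 2).
    by rewrite sqrtr_sqr normrM [`|t^-1|]ger0_norm// invr_ge0.
  rewrite expr_div_n; have : t ^+ 2 != 0 by rewrite expf_neq0.
  by move=> ?; rewrite -{1}(divff (x := t ^+ 2))// -mulrBl tE; congr (_ / _); ring.
have b0 := acos_ge0 xt; have bp := acos_lepi xt.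
have [y0|y0] := leP 0 y.
  exists t, (acos (x / t)); split => //; first lra.
    by rewrite cb mulrC divfK.
  by rewrite sb ger0_norm// mulrC divfK.
exists t, (pi *+ 2 - acos (x / t)); split => //; first by rewrite mulr2n; lra.
  by rewrite cosB cos2pi sin2pi mul1r mul0r addr0 cb mulrC divfK.
by rewrite sinB cos2pi sin2pi mul1r mul0r sub0r sb ltr0_norm// mulNr opprK mulrC divfK.
Qed.

Lemma sphere_point_surj v : sphere v ->
  exists a b, [/\ 0 <= a <= pi, 0 <= b <= 2 * pi & v = sphere_point (a, b)].
Proof.
case: v => [[x y] z]; rewrite /sphere/= /dot/= => sv.
have r0 := radius_gt0.
have [t [b [t0 b0 xE yE]]] := polar x y.
have zr : -1 <= z / Defs.radius R <= 1.
  by apply/andP; split; [rewrite ler_pdivlMr//|rewrite ler_pdivrMr//]; nra.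
exists (acos (z / Defs.radius R)), b; split => //.
  by rewrite acos_ge0// acos_lepi.
rewrite /sphere_point/= acosK// [Defs.radius R * (z / _)]mulrC divfK ?gt_eqF//.
have -> : sin (acos (z / Defs.radius R)) = t / Defs.radius R.
  rewrite sin_acos// expr_div_n (_ : 1 - _ = (t / Defs.radius R) ^+ 2).
    by rewrite sqrtr_sqr ger0_norm// divr_ge0// ltW.
  have rr : Defs.radius R ^+ 2 != 0 by rewrite expf_neq0// gt_eqF.
  rewrite expr_div_n -{1}(divff rr) -mulrBl; congr (_ / _).
  rewrite -sv xE yE; have := cos2Dsin2 b; set c := cos b; set s := sin b.
  move=> h; transitivity (t ^+ 2 * (c ^+ 2 + s ^+ 2)); first ring.
  by rewrite h mulr1.
have E (q : R) : Defs.radius R * (t / Defs.radius R * q) = t * q.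
  by field; rewrite gt_eqF.
by rewrite !E -xE -yE.
Qed.

(* Rotation taking the north pole to [sphere_point (a, b)]. *)
Definition rotation a b u : vec3 R :=
  let x := cos a * u.1.1 + sin a * u.2 in
  (cos b * x - sin b * u.1.2, sin b * x + cos b * u.1.2,
   - sin a * u.1.1 + cos a * u.2).

Definition rotation_inv a b u : vec3 R :=
  let x := cos b * u.1.1 + sin b * u.1.2 in
  (cos a * x - sin a * u.2, - sin b * u.1.1 + cos b * u.1.2,
   sin a * x + cos a * u.2).

Lemma rotationK a b u : rotation a b (rotation_inv a b u) = u.
Proof.
case: u => [[x y] z]; rewrite /rotation/rotation_inv/=.
have := cos2Dsin2 a; have := cos2Dsin2 b.
move: (cos a) (sin a) (cos b) (sin b) => c s c' s' h' h; congr (_, _, _).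
- transitivity (c' * ((c ^+ 2 + s ^+ 2) * (c' * x + s' * y)) - s' * (- s' * x + c' * y)).
    by ring.
  by rewrite h mul1r -[RHS]mul1r -h'; ring.
- transitivity (s' * ((c ^+ 2 + s ^+ 2) * (c' * x + s' * y)) + c' * (- s' * x + c' * y)).
    by ring.
  by rewrite h mul1r -[RHS]mul1r -h'; ring.
- by rewrite -[RHS]mul1r -h; ring.
Qed.

Lemma dot_rotation a b u v : dot (rotation a b u) (rotation a b v) = dot u v.
Proof.
case: u => [[x y] z]; case: v => [[x' y'] z']; rewrite /rotation/dot/=.
have := cos2Dsin2 a; have := cos2Dsin2 b.
move: (cos a) (sin a) (cos b) (sin b) => c s c' s' h' h.
transitivity ((c' ^+ 2 + s' ^+ 2) * ((c * x + s * z) * (c * x' + s * z') + y * y')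
  + (- s * x + c * z) * (- s * x' + c * z')); first by ring.
rewrite h' mul1r.
by transitivity ((c ^+ 2 + s ^+ 2) * (x * x' + z * z') + y * y'); [ring|rewrite h; ring].
Qed.

(** Moves an arbitrary centre to the north pole, where the polar coordinate is the distance. The
    right inverse [g] serves to write every point as an image under [f]. *)
Lemma sphere_rotation_exists v : sphere v -> exists f g : vec3 R -> vec3 R,
  [/\ cancel g f, (forall u, sphere (f u) <-> sphere u),
      (forall u w, angle (f u) (f w) = angle u w) & f (sphere_point (0, 0)) = v].
Proof.
move=> /sphere_point_surj[a [b [_ _ ->]]].
exists (rotation a b), (rotation_inv a b); split.
- exact: rotationK.
- by move=> u; rewrite /sphere/= dot_rotation.
- by move=> u w; rewrite /angle dot_rotation.
- by rewrite /rotation /sphere_point/= cos0 sin0; congr (_, _, _); ring.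
Qed.

Lemma angle_meridian a a' b : 0 <= a <= pi -> 0 <= a' <= pi ->
  angle (sphere_point (a, b)) (sphere_point (a', b)) = `|a - a'|.
Proof.
move=> a0 a'0; rewrite /angle -/(cosine _ _) cosine_sphere_point subrr cos0.
rewrite subrr mulr0 subr0 -cos_norm cosK// in_itv/= normr_ge0/=.
by rewrite ler_norml; lra.
Qed.

(** For the angle g between the points, g^2 / 18 <= 1 - cos g = sin^2 a (1 - cos (b - b')) <= a^2 (b
    - b')^2 / 2; the 3 is the square root of 18 / 2. *)
Lemma angle_parallel a b b' : 0 <= a ->
  angle (sphere_point (a, b)) (sphere_point (a, b')) <= 3 * (a * `|b - b'|).
Proof.
move=> a0; set u := sphere_point _; set v := sphere_point _.
have su : sphere u := sphere_sphere_point _.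
have sv : sphere v := sphere_sphere_point _.
have g0 := angle_ge0 su sv.
have := @cos_le _ (angle u v) ltac:(rewrite ger0_norm// angle_lepi//).
rewrite cos_angle// /u /v cosine_sphere_point -/u -/v subrr cos0 => h.
have cg := @cos_ge _ (b - b').
have c1 := cos_le1 (b - b').
have s2 : sin a * sin a <= a ^+ 2.
  have s1 := sin_le a0; have [s0|s0] := leP 0 (sin a); first by nra.
  have := cos2Dsin2 a; rewrite -expr2.
  have [a1|a1] := leP 1 a; first by nra.
  by have := @sin_ge0_pi _ a ltac:(have := @pi_ge2 R; lra); lra.
have s0 : 0 <= sin a * sin a by rewrite -expr2 sqr_ge0.
have h2 : angle u v ^+ 2 <= (3 * (a * `|b - b'|)) ^+ 2.
  rewrite !exprMn real_normK ?num_real//.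
  have : sin a * sin a * (1 - cos (b - b')) <= a ^+ 2 * ((b - b') ^+ 2 / 2).
    by apply: ler_pM => //; lra.
  by move: h; nra.
have : 0 <= 3 * (a * `|b - b'|) by rewrite !mulr_ge0.
by move: h2; rewrite !expr2 => h3 ?; rewrite leNgt; apply/negP => ?; nra.
Qed.

(** The path follows the meridian first and then the parallel of the second point, so that the
    azimuthal error is scaled by the polar angle [a'] of the target. *)
Lemma angle_sphere_point_le a b a' b' : 0 <= a <= pi -> 0 <= a' <= pi ->
  angle (sphere_point (a, b)) (sphere_point (a', b')) <= `|a - a'| + 3 * (a' * `|b - b'|).
Proof.
move=> a0 a'0.
apply: le_trans (angle_triangle (sphere_sphere_point _)
  (sphere_sphere_point (a', b)) (sphere_sphere_point _)) _.
rewrite lerD// ?angle_meridian//; apply: angle_parallel.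
by case/andP: a'0.
Qed.

Lemma exists_at_angle v a : sphere v -> 0 <= a <= pi ->
  exists2 q, sphere q & angle v q = a.
Proof.
move=> /sphere_rotation_exists[f [g [gK fS fA <-]]] a0.
exists (f (sphere_point (a, 0))); first exact/fS/sphere_sphere_point.
rewrite fA angle_meridian ?lexx ?pi_ge0//.
by rewrite sub0r normrN ger0_norm//; case/andP: a0.
Qed.

Lemma grid_approx (n : nat) x : (0 < n)%N -> 0 <= x <= 1 ->
  exists k : 'I_n, `|x - k%:R / n%:R| <= n%:R^-1 :> R.
Proof.
move=> n0 /andP[x0 x1].
have nR : 0 < n%:R :> R by rewrite ltr0n.
have [xlt|] := ltP x 1; last first.
  (* At x = 1 the integer part of x n is n, outside the index range; the last index n - 1 errs by
     exactly 1 / n. *)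
  move=> x1'; have {x0 x1 x1'} -> : x = 1 by apply/eqP; rewrite eq_le x1.
  case: n n0 nR => // n _ nR; exists ord_max => /=.
  rewrite -{1}(divff (x := n.+1%:R))// -mulrBl -natrB// subSnn mul1r.
  by rewrite ger0_norm// invr_ge0 ltW.
have /andP[kx xk] := truncn_itv (mulr_ge0 x0 (ltW nR)).
set k := Num.truncn (x * n%:R) in kx xk.
have kn : (k < n)%N by rewrite -(ltr_nat R); apply: le_lt_trans kx _; rewrite gtr_pMl.
exists (Ordinal kn) => /=.
have -> : x - k%:R / n%:R = (x * n%:R - k%:R) / n%:R by rewrite mulrBl mulfK// gt_eqF.
rewrite normrM [`|n%:R^-1|]ger0_norm; last by rewrite invr_ge0 ltW.
apply: ler_piMl; rewrite ?invr_ge0 ?ltW// ger0_norm ?subr_ge0//.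
by move: xk; rewrite -natr1; lra.
Qed.

(** Later [n] is also the number of vertices: n^2 centres cost only a polynomial factor in a union
    bound, and the mesh of order 1 / n is far finer than r = n^(eps - 1/2). *)
Definition grid_point (n : nat) (kl : 'I_n * 'I_n) : vec3 R :=
  sphere_point (pi * (kl.1%:R / n%:R : R), 2 * pi * (kl.2%:R / n%:R : R)).

(** With pi < 4 the polar error is at most 4 / n and the azimuthal one at most 3 times 4 times 8 /
    n, in total 100 / n. *)
Lemma grid_point_dense (n : nat) v : (0 < n)%N -> sphere v ->
  exists kl : 'I_n * 'I_n, angle v (grid_point kl) <= 100 / n%:R.
Proof.
move=> n0 /sphere_point_surj[a [b [a0 b0 ->]]].
have p0 := @pi_gt0 R; have p4 := @pi_lt4 R.
have nV : 0 < n%:R^-1 :> R by rewrite invr_gt0 ltr0n.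
have [|k hk] := @grid_approx n (a / pi) n0.
  by apply/andP; split; [apply: divr_ge0; lra|rewrite ler_pdivrMr//; lra].
have [|l hl] := @grid_approx n (b / (2 * pi)) n0.
  by apply/andP; split; [apply: divr_ge0; lra|rewrite ler_pdivrMr; lra].
exists (k, l); rewrite /grid_point/=.
have k0 : 0 <= (k%:R / n%:R : R) <= 1.
  by rewrite divr_ge0//= ler_pdivrMr ?ltr0n// mul1r ler_nat ltnW.
apply: le_trans (angle_sphere_point_le _ _ a0 _) _; first by nra.
have -> : a - pi * (k%:R / n%:R) = pi * (a / pi - k%:R / n%:R) by rewrite mulrBr [_ * (a / _)]mulrC divfK// gt_eqF.
have -> : b - 2 * pi * (l%:R / n%:R) = 2 * pi * (b / (2 * pi) - l%:R / n%:R).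
  by rewrite mulrBr [_ * (b / _)]mulrC divfK// gt_eqF// mulr_gt0.
rewrite !normrM [`|pi|]gtr0_norm// [`|2|]gtr0_norm//.
move: hk hl k0 (normr_ge0 (a / pi - k%:R / n%:R)) (normr_ge0 (b / (2 * pi) - l%:R / n%:R)).
move: nV; move: `|a / pi - _| `|b / _ - _| => x y; move: (k%:R / n%:R) => q.
move: (n%:R^-1) => e e0 xe ye q0 x0 y0.
have h1 : pi * x <= 4 * e by apply: ler_pM => //; lra.
have h2 : pi * q <= 4 * 1 by apply: ler_pM => //; lra.
have h3 : 2 * pi * y <= 8 * e by apply: ler_pM => //; lra.
have h4 : pi * q * (2 * pi * y) <= 4 * (8 * e).
  by apply: ler_pM => //; rewrite ?mulr_ge0//; lra.
by lra.
Qed.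

(** The centres are equally spaced on the circle of radius a about v. A point is first moved
    radially by at most d, then along the circle by at most 3 a times 8 / N. *)
Lemma annulus_cover (N : nat) v a : (0 < N)%N -> sphere v -> 0 <= a <= pi ->
  exists q : 'I_N -> vec3 R, (forall k, sphere (q k)) /\
    forall u (d : R), sphere u -> `|angle u v - a| <= d ->
      exists k, angle u (q k) <= d + 24 * a / N%:R.
Proof.
move=> N0 sv a0; have [f [g [gK fS fA <-]]] := sphere_rotation_exists sv.
exists (fun k : 'I_N => f (sphere_point (a, 2 * pi * (k%:R / N%:R)))); split.
  by move=> k; exact/fS/sphere_sphere_point.
have p0 := @pi_gt0 R; have p4 := @pi_lt4 R.
move=> u d; rewrite -(gK u) fS => /sphere_point_surj[a' [b [a'0 b0 ->]]].
rewrite fA -[sphere_point (0, 0)](_ : sphere_point (0, b) = _); last first.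
  by rewrite /sphere_point/= sin0 !mul0r.
rewrite angle_meridian//; last by rewrite lexx ltW.
rewrite subr0 [`|a'|]ger0_norm; last by case/andP: a'0.
move=> hd.
have [|l hl] := @grid_approx N (b / (2 * pi)) N0.
  by apply/andP; split; [apply: divr_ge0; lra|rewrite ler_pdivrMr; lra].
exists l; rewrite fA; apply: le_trans (angle_sphere_point_le _ _ a'0 a0) _.
rewrite lerD//.
have -> : b - 2 * pi * (l%:R / N%:R) = 2 * pi * (b / (2 * pi) - l%:R / N%:R).
  by rewrite mulrBr [_ * (b / _)]mulrC divfK// gt_eqF// mulr_gt0.
rewrite !normrM [`|pi|]gtr0_norm// [`|2|]gtr0_norm//.
move: hl (normr_ge0 (b / (2 * pi) - l%:R / N%:R)); rewrite -[24 * a / _]mulrA [a / _]mulrC.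
move: `|b / _ - _| => y; move: (N%:R^-1) => e ye y0.
have h3 : 2 * pi * y <= 8 * e by apply: ler_pM => //; lra.
have h4 : a * (2 * pi * y) <= a * (8 * e) by apply: ler_wpM2l => //; lra.
by lra.
Qed.

End SphereGeometry.

(** * Area of caps *)

(** A linear inequality in u, so measurable in all of [vec3 R]; [angle_cap] identifies it on the
    sphere with the ball of radius a, for a in [0, pi]. *)
Definition cap (R : realType) (v : vec3 R) (a : R) : set (vec3 R) :=
  [set u | cos a <= cosine u v].

Section CapArea.
Context {R : realType}.
Implicit Types (u v : vec3 R) (a b : R).
Notation leb := (@lebesgue_measure R).

Lemma measurable_fun_cosine d (T : measurableType d) (f g : T -> vec3 R) :
  measurable_fun setT f -> measurable_fun setT g ->
  measurable_fun setT (fun t => cosine (f t) (g t)).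
Proof.
move=> mf mg; rewrite /cosine /dot.
have m1 (h : T -> vec3 R) : measurable_fun setT h ->
    [/\ measurable_fun setT (fun t => (h t).1.1),
        measurable_fun setT (fun t => (h t).1.2) &
        measurable_fun setT (fun t => (h t).2)].
  move=> mh.
  have m2 : measurable_fun setT (fst \o h) by exact: measurableT_comp.
  split; first exact: (measurableT_comp measurable_fst m2).
    exact: (measurableT_comp measurable_snd m2).
  exact: (measurableT_comp measurable_snd mh).
have [f1 f2 f3] := m1 _ mf; have [g1 g2 g3] := m1 _ mg.
apply: measurable_funM => //.
by apply: measurable_funD; [apply: measurable_funD|]; apply: measurable_funM.
Qed.

Lemma measurable_cap v a : measurable (cap v a).
Proof.
rewrite -[cap _ _]setTI; apply: measurable_fun_le => //.
by apply: measurable_fun_cosine => //; exact: measurable_id.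
Qed.

Lemma angle_cap u v a : sphere u -> sphere v -> 0 <= a <= pi ->
  (angle u v <= a) = (u \in cap v a).
Proof.
move=> su sv a0; rewrite angle_le_cos//; apply/idP/idP => [h|].
  by rewrite inE.
by rewrite inE.
Qed.

Lemma measurable_sphere_point : measurable_fun setT (@sphere_point R).
Proof.
have mc : measurable_fun setT (@cos R) by apply: continuous_measurable_fun; exact: continuous_cos.
have ms : measurable_fun setT (@sin R) by apply: continuous_measurable_fun; exact: continuous_sin.
have m1 : measurable_fun [set: R * R] fst by exact: measurable_fst.
have m2 : measurable_fun [set: R * R] snd by exact: measurable_snd.
have c1 := measurableT_comp mc m1; have c2 := measurableT_comp mc m2.
have s1 := measurableT_comp ms m1; have s2 := measurableT_comp ms m2.
apply: measurable_fun_pair; first apply: measurable_fun_pair.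
- by apply: measurable_funM => //; exact: (measurable_funM s1 c2).
- by apply: measurable_funM => //; exact: (measurable_funM s1 s2).
- exact: (measurable_funM (@measurable_cst _ _ _ _ _ _) c1).
Qed.

Definition area_density (B : set (vec3 R)) (p : R * R) : \bar R :=
  (Defs.radius R ^+ 2 * sin p.1 * \1_B (sphere_point p))%:E.

Let D := (`[0, pi] `*` `[0, 2 * pi])%R : set (R * R).

Lemma measurable_domain : measurable D.
Proof. exact: measurableX. Qed.

Lemma measurable_area_density B : measurable B -> measurable_fun setT (area_density B).
Proof.
move=> mB; apply/measurable_EFinP; apply: measurable_funM; first apply: measurable_funM => //.
  have ms : measurable_fun setT (@sin R) by apply: continuous_measurable_fun; exact: continuous_sin.
  exact: (measurableT_comp ms measurable_fst).
apply: measurableT_comp; last exact: measurable_sphere_point.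
exact: measurable_indic.
Qed.

Lemma area_density_ge0 B p : D p -> (0 <= area_density B p)%E.
Proof.
case=> /=; rewrite in_itv/= => p1 _; rewrite lee_fin.
apply: mulr_ge0 => //; apply: mulr_ge0; last exact: sin_ge0_pi.
exact: sqr_ge0.
Qed.

Lemma area_le (B : set (vec3 R)) (I J : set R) c : measurable B -> measurable I ->
  measurable J -> 0 <= c ->
  (forall a b, 0 <= a <= pi -> 0 <= b <= 2 * pi -> B (sphere_point (a, b)) ->
    [/\ I a, J b & Defs.radius R ^+ 2 * sin a <= c]) ->
  (area B <= c%:E * (leb I * leb J))%E.
Proof.
move=> mB mI mJ c0 h; rewrite /area -product_measure1E//.
apply: (@le_trans _ _ (\int[leb \x leb]_(p in D) (c%:E * (\1_(I `*` J) p)%:E))%E).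
  apply: ge0_le_integral => //.
  - exact: measurable_domain.
  - exact: area_density_ge0.
  - apply: measurable_funTS; exact: measurable_area_density.
  - by apply: measurable_funTS; apply: emeasurable_funM => //; apply/measurable_EFinP;
      apply: measurable_indic; exact: measurableX.
  - move=> [a b] [/=]; rewrite !in_itv/= => a0 b0.
    rewrite -EFinM lee_fin !indicE.
    have [Bp|Bp] := boolP (sphere_point (a, b) \in B); last by rewrite mulr0 mulr_ge0.
    have [Ia Jb k] := h a b a0 b0 (set_mem Bp).
    by rewrite mem_set// !mulr1.
rewrite ge0_integralZl_EFin//; first last.
- by apply/measurable_EFinP; apply: measurable_indic; exact: measurableX.
- exact: measurable_domain.
rewrite lee_wpmul2l//; rewrite integral_indic//; first last.
- exact: measurableX.
- exact: measurable_domain.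
apply: le_measure; rewrite ?inE; [|exact: measurableX|exact: subIsetl].
by apply: measurableI; [exact: measurableX|exact: measurable_domain].
Qed.

Lemma area_ge (B : set (vec3 R)) (I J : set R) c : measurable B -> measurable I ->
  measurable J -> 0 <= c ->
  (forall a b, I a -> J b -> [/\ 0 <= a <= pi, 0 <= b <= 2 * pi,
    B (sphere_point (a, b)) & c <= Defs.radius R ^+ 2 * sin a]) ->
  (c%:E * (leb I * leb J) <= area B)%E.
Proof.
move=> mB mI mJ c0 h; rewrite /area -product_measure1E//.
have mX : measurable (I `*` J) by exact: measurableX.
apply: (@le_trans _ _ (\int[leb \x leb]_(p in (I `*` J)) area_density B p)%E).
  rewrite -integral_cst//; apply: ge0_le_integral => //.
  - apply: measurable_funTS; exact: measurable_area_density.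
  - move=> [a b] [/= Ia Jb]; have [a0 b0 Bp k] := h a b Ia Jb.
    by rewrite lee_fin indicE mem_set// mulr1.
apply: ge0_subset_integral => //.
- exact: measurable_domain.
- apply: measurable_funTS; exact: measurable_area_density.
- exact: area_density_ge0.
- by move=> [a b] [/= Ia Jb]; have [? ? _ _] := h a b Ia Jb; split => /=; rewrite in_itv.
Qed.

Lemma radius2E : Defs.radius R ^+ 2 = (4 * pi)^-1.
Proof.
rewrite /Defs.radius exprVn exprMn sqr_sqrtr ?pi_ge0//.
by rewrite -natrX.
Qed.

Lemma radius2_bounds : 1 / 16 <= Defs.radius R ^+ 2 <= 1 / 8.
Proof.
have p2 := @pi_ge2 R; have p4 := @pi_lt4 R.
by rewrite radius2E !div1r !lef_pV2 ?posrE; lra.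
Qed.

Lemma leb_itvcc a b : a <= b -> leb `[a, b] = (b - a)%:E.
Proof.
move=> ab; rewrite lebesgue_measure_itv/= lte_fin.
by case: ltgtP ab => // -> _; rewrite subrr.
Qed.

Lemma sin_perturb a t : 0 <= sin a -> sin (a + t) <= sin a + `|t|.
Proof.
move=> s0; rewrite sinD.
have h1 : sin a * cos t <= sin a by rewrite -[leRHS]mulr1 ler_wpM2l// cos_le1.
have h2 : cos a * sin t <= `|t|.
  apply: le_trans (ler_norm _) _; rewrite normrM.
  apply: le_trans (_ : 1 * `|sin t| <= _); first by rewrite ler_wpM2r// cos_max.
  rewrite mul1r; have [t0|t0] := leP 0 t.
    have [st|st] := leP 0 (sin t); first by rewrite (ger0_norm t0) ger0_norm// sin_le.
    rewrite (ger0_norm t0) ltr0_norm//.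
    have [t1|t1] := leP 1 t; first by have := sin_geN1 t; lra.
    by have := @sin_ge0_pi _ t ltac:(have := @pi_ge2 R; lra); lra.
  have t0' : 0 <= - t by lra.
  rewrite (ltr0_norm t0) -normrN -sinN; have [st|st] := leP 0 (sin (- t)).
    by rewrite ger0_norm// sin_le.
  rewrite ltr0_norm//; have [t1|t1] := leP 1 (- t); first by have := sin_geN1 (-t); lra.
  by have := @sin_ge0_pi _ (-t) ltac:(have := @pi_ge2 R; lra); lra.
by lra.
Qed.

End CapArea.

Section CapAreaBounds.
Context {R : realType}.
Implicit Types (u v : vec3 R) (a b : R).
Notation leb := (@lebesgue_measure R).

Lemma area_cap_le v a : sphere v -> 0 <= a <= pi ->
  (area (cap v a) <= (100 * a ^+ 2)%:E)%E.
Proof.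
move=> /sphere_point_surj[al [be [al0 be0 ->]]].
have p2 := @pi_ge2 R; have p4 := @pi_lt4 R.
have sal := sin_ge0_pi al0.
move=> /andP[a0 api]; have [az|an] := eqVneq a 0.
  (* A cap of radius 0 lies on one parallel; the enclosing box has measure 0 times infinity, which
     is 0. *)
  have := @area_le _ (cap (sphere_point (al, be)) a) `[al, al] setT 1 (measurable_cap _ _).
  have -> : leb `[al, al] = 0%E by rewrite leb_itvcc// subrr.
  rewrite mul0e mule0 az expr0n/= mulr0; apply => // x b x0 b0.
  rewrite /cap/= cos0 cosine_sphere_point => h; split => //.
    have h2 : 0 <= sin x * sin al * (1 - cos (b - be)).
      by rewrite !mulr_ge0 ?subr_ge0 ?cos_le1// sin_ge0_pi.
    have h3 := @cos_le _ (x - al) ltac:(rewrite ler_norml; lra).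
    have /eqP : (x - al) ^+ 2 = 0 by apply/eqP; rewrite eq_le sqr_ge0; lra.
    by rewrite sqrf_eq0 subr_eq0 => /eqP->; rewrite in_itv/= lexx.
  have /andP[r1 r2] := @radius2_bounds R; have := sin_le1 x; have := sin_ge0_pi x0; nra.
have {an a0} a0 : 0 < a by rewrite lt_neqAle eq_sym an.
(* The cap lies in the strip of points whose polar angle differs by at most [a]
   from that of the centre; there, modulo 2 pi, the azimuths differ by at most [h]. *)
pose M := sin al + a; have M0 : 0 < M by rewrite /M; lra.
pose h := 12 * a / M; have h0 : 0 <= h by rewrite divr_ge0//; lra.
pose J i := [set` `[be + i * (2 * pi) - h, be + i * (2 * pi) + h]].
have mJ i : measurable (J i) by exact: measurable_itv.
have lJ i : leb (J i) = (2 * h)%:E by rewrite leb_itvcc; [congr EFin|]; lra.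
have /andP[r1 r2] := @radius2_bounds R.
pose I := [set` `[al - a, al + a]].
pose J3 := J 0 `|` (J 1 `|` J (-1)).
have mI : measurable I by exact: measurable_itv.
have mJ3 : measurable J3 by apply: measurableU => //; apply: measurableU.
apply: (@le_trans _ _ ((Defs.radius R ^+ 2 * M)%:E * (leb I * leb J3))%E).
  apply: area_le => //.
  - exact: measurable_cap.
  - by rewrite mulr_ge0//; lra.
  move=> x b x0 b0; rewrite /cap/= cosine_sphere_point => hx.
  have sx := sin_ge0_pi x0; have cb := cos_le1 (b - be).
  have ss : 0 <= sin x * sin al * (1 - cos (b - be)) by rewrite !mulr_ge0//; lra.
  have xal : `|x - al| <= a.
    rewrite -ler_cos ?cos_norm; [lra|by rewrite (ltW a0)|].
    by rewrite normr_ge0/= ler_norml; lra.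
  have sxM : sin x <= M.
    rewrite (_ : x = al + (x - al)); last by lra.
    by have := sin_perturb (x - al) sal; rewrite /M; lra.
  split.
  - by rewrite /I/= in_itv/=; move: xal; rewrite ler_norml; lra.
  - have key (t : R) : `|t| <= pi -> cos (b - be) = cos t -> `|t| <= h.
      move=> tp ct; have := cos_le tp; have := @cos_ge _ a; have := cos_le1 (x - al).
      rewrite -ct => c1 c2 c3.
      have q : sin x * sin al * t ^+ 2 <= 9 * a ^+ 2.
        have : sin x * sin al * (t ^+ 2 / 18) <= sin x * sin al * (1 - cos (b - be)).
          by rewrite ler_wpM2l ?mulr_ge0//; lra.
        by lra.
      rewrite /h ler_pdivlMr//.
      (* If sin al < 2a, then M < 3a and h exceeds 4 > pi, so the azimuth is unrestricted; this case
         dictates the 12 in [h]. Otherwise sin x >= sin al / 2 and M <= 3/2 sin al, and the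
         quadratic bound [q] suffices. *)
      have [big|small] := leP (2 * a) (sin al); last first.
        apply: le_trans (_ : 4 * (3 * a) <= _); last by lra.
        by have := normr_ge0 t; move: tp; rewrite /M => tp tn; apply: ler_pM; lra.
      have sl : sin al / 2 <= sin x.
        have := sin_perturb (al - x) sx.
        by rewrite addrC subrK -normrN opprB; lra.
      have q2 : (sin al * `|t|) ^+ 2 <= 18 * a ^+ 2.
        rewrite exprMn real_normK ?num_real//.
        have : (sin al / 2) * sin al * t ^+ 2 <= sin x * sin al * t ^+ 2.
          by rewrite ler_wpM2r ?sqr_ge0// ler_wpM2r//; lra.
        by rewrite !expr2; lra.
      have q3 : sin al * `|t| <= 5 * a.
        have : 0 <= sin al * `|t| by rewrite mulr_ge0.
        by move: q2; rewrite !expr2 => q2 ?; rewrite leNgt; apply/negP => ?; nra.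
      apply: (@le_trans _ _ (`|t| * (sin al * 3 / 2))).
        by rewrite ler_wpM2l// /M; lra.
      by lra.
    have inJ i : `|b - be - i * (2 * pi)| <= h -> J i b.
      by rewrite ler_norml /J/= in_itv/=; lra.
    have c2 y : cos (y + 2 * pi) = cos y by rewrite mulr_natl cosD2pi.
    have [g1|g1] := leP (b - be) pi.
      have [g2|g2] := leP (- pi) (b - be).
        left; apply: inJ; apply: key; first by rewrite ler_norml; lra.
        by congr cos; lra.
      right; right; apply: inJ; apply: key; first by rewrite ler_norml; lra.
      by rewrite -[LHS]c2; congr cos; lra.
    right; left; apply: inJ; apply: key; first by rewrite ler_norml; lra.
    by rewrite -[RHS]c2; congr cos; lra.
  - by rewrite ler_wpM2l//; lra.
rewrite leb_itvcc; last by lra.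
apply: (@le_trans _ _ ((Defs.radius R ^+ 2 * M)%:E *
    ((al + a - (al - a))%:E * (6 * h)%:E))%E).
  rewrite lee_wpmul2l//; first by rewrite lee_fin; apply: mulr_ge0; lra.
  rewrite lee_wpmul2l ?lee_fin//; first by lra.
  have mJ1 : measurable (J 1 `|` J (-1)) by exact: measurableU.
  have U1 : (leb J3 <= leb (J 0%R) + leb (J 1%R `|` J (-1)%R))%E by apply: measureU2; first exact: mJ.
  have U2 : (leb (J 1%R `|` J (-1)%R) <= leb (J 1%R) + leb (J (-1)%R))%E by apply: measureU2; exact: mJ.
  rewrite !lJ in U1 U2; apply: (le_trans U1).
  apply: le_trans (leeD2l _ U2) _.
  by rewrite -!EFinD lee_fin; lra.
rewrite -!EFinM lee_fin.
have -> : Defs.radius R ^+ 2 * M * ((al + a - (al - a)) * (6 * h)) =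
    Defs.radius R ^+ 2 * (144 * a ^+ 2) by rewrite /h; field; rewrite gt_eqF.
by have a2 := sqr_ge0 a; have := ler_wpM2r a2 r2; lra.
Qed.

End CapAreaBounds.

Section CapAreaBounds.
Context {R : realType}.
Implicit Types (u v : vec3 R) (a b : R).
Notation leb := (@lebesgue_measure R).

Lemma area_cap_ge v a : sphere v -> 0 <= a <= 1 ->
  (((a / 400) ^+ 2)%:E <= area (cap v a))%E.
Proof.
move=> /sphere_point_surj[al [be [al0 be0 ->]]].
have p2 := @pi_ge2 R; have p4 := @pi_lt4 R.
have sal := sin_ge0_pi al0.
have mc w : measurable (cap w a) by exact: measurable_cap.
move=> /andP[a0 a1]; have [az|an] := eqVneq a 0.
  have := @area_ge _ (cap (sphere_point (al, be)) a) set0 set0 0 (mc _).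
  by rewrite az mul0r expr0n/= mul0e; apply.
have {an a0} a0 : 0 < a by rewrite lt_neqAle eq_sym an.
(* A rectangle in spherical coordinates, shifted from the centre towards the
   equator so that [sin] is at least of order [M] on it. *)
pose M := sin al + a; have M0 : 0 < M by rewrite /M; lra.
(* With this width the azimuthal loss is at most M^2 h^2 / 2 = a^2 / 32; a polar shift of at most a
   / 8 loses at most a^2 / 128. Together they stay below a^2 / 18 <= 1 - cos a. *)
pose h := a / (4 * M).
have h0 : 0 <= h by rewrite divr_ge0//; lra.
have h1 : h <= 1 / 4.
  rewrite /h ler_pdivrMr; last by lra.
  by rewrite /M; lra.
have /andP[r1 r2] := @radius2_bounds R.
have [J0 [J1 [J01 J0p J1p Jbe]]] : exists x y : R,
    [/\ y = x + h, 0 <= x, y <= 2 * pi & forall b, x <= b <= y -> `|b - be| <= h].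
  have [bp|bp] := leP be pi.
    by exists be, (be + h); split; [| |lra|move=> b ?; rewrite ler_norml]; lra.
  by exists (be - h), be; split; [| | |move=> b ?; rewrite ler_norml]; lra.
have [I0 [I1 [I01 I0p I1p Ial]]] : exists x y : R,
    [/\ y = x + a / 16, 0 <= x, y <= pi & forall t, x <= t <= y ->
      `|t - al| <= a / 8 /\ M / 96 <= sin t].
  (* Here c is the absolute value of cos al. Either sin al or c is at least 1/2; in the second case
     c sin t >= a / 96, as sin t >= t / 3 >= a / 48. *)
  have key t c : a / 16 <= t <= a / 8 -> 0 <= c -> c ^+ 2 + sin al ^+ 2 = 1 ->
      M / 96 <= sin al * cos t + c * sin t.
    move=> t0 c0 cE.
    have := @cos_ge _ t; have := @sin_ge_third _ t ltac:(lra) => st ct.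
    have ct2 : 1 / 2 <= cos t by nra.
    have e1 : sin al * (1 / 2) <= sin al * cos t by rewrite ler_wpM2l.
    have e2 : c * (a / 48) <= c * sin t by rewrite ler_wpM2l//; lra.
    have [s2|s2] := leP (1 / 2) (sin al); first by rewrite /M; nra.
    have c2 : 1 / 2 <= c by nra.
    by rewrite /M; nra.
  have csal := cos2Dsin2 al.
  have [ap|ap] := leP al (pi / 2).
    exists (al + a / 16), (al + a / 8); split; [lra|lra|lra|move=> t t0].
    split; first by rewrite ler_norml; lra.
    rewrite (_ : t = al + (t - al)); last by lra.
    rewrite sinD; apply: key => //; first by lra.
    by apply: cos_ge0_pihalf; lra.
  exists (al - a / 8), (al - a / 16); split; [lra|lra|lra|move=> t t0].
  split; first by rewrite ler_norml; lra.
  rewrite (_ : t = al - (al - t)); last by lra.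
  rewrite sinB -mulNr; apply: key => //; first by lra.
    by have := @cos_ge0_pihalf _ (pi - al) ltac:(lra); rewrite cosB cospi sinpi; lra.
  by rewrite sqrrN.
apply: (@le_trans _ _ ((Defs.radius R ^+ 2 * (M / 96))%:E *
    (leb `[I0, I1] * leb `[J0, J1]))%E).
  rewrite !leb_itvcc; [|lra|lra].
  rewrite -!EFinM lee_fin J01 I01.
  have -> : Defs.radius R ^+ 2 * (M / 96) * ((I0 + a / 16 - I0) * (J0 + h - J0)) =
    Defs.radius R ^+ 2 * (a ^+ 2 / (96 * 64)) by rewrite /h; field; rewrite gt_eqF.
  by have : 0 <= a ^+ 2 by [exact: sqr_ge0|]; nra.
apply: area_ge => //.
  by apply: mulr_ge0; lra.
move=> x b /=; rewrite !in_itv/= => x0 b0.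
have [xal sx] := Ial _ x0; have bbe := Jbe _ b0.
have xp : 0 <= x <= pi by lra.
have sx0 := sin_ge0_pi xp.
split => //; [lra| |by rewrite ler_wpM2l//; lra].
rewrite /cap/= cosine_sphere_point.
have sxM : sin x <= M.
  rewrite (_ : x = al + (x - al)); last by lra.
  by have := sin_perturb (x - al) sal; rewrite /M; lra.
have cx := @cos_ge _ (x - al); have cb := @cos_ge _ (b - be).
have ca := @cos_le _ a ltac:(rewrite ger0_norm; lra).
have n2 y z : `|y| <= z -> y ^+ 2 <= z ^+ 2 :> R.
  by move=> yz; rewrite -real_normK ?num_real// ler_pXn2r// nnegrE// (le_trans _ yz).
have x2 := n2 _ _ xal; have b2 := n2 _ _ bbe.
have hM : (M * h) ^+ 2 = a ^+ 2 / 16 by rewrite /h; field; rewrite gt_eqF.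
have k : sin x * sin al * (1 - cos (b - be)) <= M * M * (h ^+ 2 / 2).
  apply: ler_pM; rewrite ?mulr_ge0 ?subr_ge0 ?cos_le1//; last by lra.
  by apply: ler_pM; rewrite // /M; lra.
have : M * M * (h ^+ 2 / 2) = (M * h) ^+ 2 / 2 by ring.
rewrite hM.
have : (a / 8) ^+ 2 = a ^+ 2 / 64 by field.
by have := sqr_ge0 a; lra.
Qed.

End CapAreaBounds.

(** * Concentration for adapted sequences *)

Section RealProbability.
Context d (T : measurableType d) (R : realType) (P : probability T R).
Implicit Types (A B : set T).

Definition prob A : R := fine (P A).

Lemma probE A : measurable A -> P A = (prob A)%:E.
Proof. by move=> mA; rewrite fineK// fin_num_measure. Qed.

Lemma prob_ge0 A : 0 <= prob A.
Proof. exact: fine_ge0. Qed.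

Lemma le_prob A B : measurable A -> measurable B -> A `<=` B -> prob A <= prob B.
Proof.
move=> mA mB AB; rewrite -lee_fin -!probE//.
by apply: le_measure; rewrite ?inE.
Qed.

Lemma prob_set0 : prob set0 = 0.
Proof. by rewrite /prob measure0. Qed.

Lemma prob_setC A : measurable A -> prob (~` A) = 1 - prob A.
Proof.
move=> mA; have := @probability_setC _ _ _ P A mA.
rewrite (probE mA) probE; last exact: measurableC.
by rewrite -EFinB => -[].
Qed.

Lemma prob_partition (I : finType) (X : T -> I) A :
  measurable A -> (forall i, measurable (A `&` X @^-1` [set i])) ->
  prob A = \sum_i prob (A `&` X @^-1` [set i]).
Proof.
move=> mA mX.
have TE : [set: I] = [set` enum I] by apply/seteqP; split=> i //= _; rewrite mem_enum.
have E : A = \bigcup_(i in [set` enum I]) (A `&` X @^-1` [set i]).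
  by apply/seteqP; split=> [w Aw|w [i _ []]//]; exists (X w); rewrite // -TE.
apply: EFin_inj; rewrite -probE// {1}E measure_fin_bigcup//; last first.
  by move=> i j _ _ [w [[_ <-] [_ <-]]].
rewrite -fsbig_seq ?enum_uniq// -big_enum/= -sumEFin; apply: eq_bigr => i _.
by rewrite probE.
Qed.

Lemma prob_setU_le A B : measurable A -> measurable B ->
  prob (A `|` B) <= prob A + prob B.
Proof.
move=> mA mB; rewrite -lee_fin EFinD -!probE//; last exact: measurableU.
exact: measureU2.
Qed.

Lemma measurable_exists (I : finType) (F : I -> set T) :
  (forall i, measurable (F i)) -> measurable [set w | exists i, F i w].
Proof.
move=> mF; have -> : [set w | exists i, F i w] = \bigcup_(i in [set: I]) F i.
  by apply/seteqP; split=> [w [i Fi]|w [i _ Fi]]; exists i.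
exact: fin_bigcup_measurable.
Qed.

Lemma prob_exists_le (I : finType) (F : I -> set T) c :
  (forall i, measurable (F i)) -> (forall i, prob (F i) <= c) ->
  prob [set w | exists i, F i w] <= #|I|%:R * c.
Proof.
move=> mF Fc.
have -> : [set w | exists i, F i w] = \big[setU/set0]_(i <- enum I) F i.
  by rewrite -bigcup_seq; apply/seteqP; split=> [w [i Fi]|w [i _ Fi]]; exists i;
    rewrite //= mem_enum.
rewrite cardE; elim: (enum I) => [|i s IH]; first by rewrite big_nil prob_set0 mul0r.
rewrite big_cons; apply: le_trans (prob_setU_le _ _) _ => //.
  exact: bigsetU_measurable.
by rewrite /= -natr1 mulrDl mul1r addrC lerD.
Qed.

(* A Chernoff bound for adapted sequences: the hypothesis on [g] says that
   exp (\sum_(i < j) g i (tau i)) is a supermartingale for the filtration F. *)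
Lemma adaptive_tail (n : nat) (I : finType) (F : nat -> set (set T))
    (tau : 'I_n -> T -> I) (g : 'I_n -> I -> R) :
  (forall j A, F j A -> measurable A) ->
  (forall (j : 'I_n) i A, F j A -> F j.+1 (A `&` tau j @^-1` [set i])) ->
  (forall (j : 'I_n) A, F j A ->
    \sum_i expR (g j i) * prob (A `&` tau j @^-1` [set i]) <= prob A) ->
  forall A t, F 0%N A ->
    let E := A `&` [set w | t <= \sum_(j < n) g j (tau j w)] in
    measurable E /\ prob E <= expR (- t) * prob A.
Proof.
move=> mF tauF sup A t FA.
(* Induction on the number k of remaining steps, for all events and thresholds at once: splitting on
   the value i of the next step refines A and lowers t by [g j i]. This replaces conditional
   expectations by finite sums. *)
suff H k : (k <= n)%N -> forall A t, F (n - k)%N A ->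
    let E := A `&` [set w | t <= \sum_(j < n | (n - k <= j)%N) g j (tau j w)] in
    measurable E /\ prob E <= expR (- t) * prob A.
  have := H n (leqnn n) A t; rewrite subnn => /(_ FA) /=.
  by under eq_set => w do rewrite (eq_bigl xpredT)//.
elim: k => [_|k IH kn] {}A {}t {}FA /=.
  have mA := mF _ _ FA.
  have E0 w : \sum_(j < n | (n - 0 <= j)%N) g j (tau j w) = 0.
    by rewrite big1// => j; rewrite subn0 leqNgt ltn_ord.
  under eq_set => w do rewrite E0.
  have [t0|t0] := leP t 0.
    rewrite (_ : [set _ | _] = setT); last by apply/seteqP; split.
    rewrite setIT; split => //; rewrite ler_peMl ?prob_ge0//.
    by rewrite leNgt expR_lt1 -leNgt oppr_ge0.
  rewrite (_ : [set _ | _] = set0); last by apply/seteqP; split.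
  by rewrite setI0 prob_set0; split => //; rewrite mulr_ge0 ?prob_ge0 ?expR_ge0.
have jn : (n - k.+1 < n)%N by rewrite ltn_subrL/= (leq_trans _ kn).
pose j := Ordinal jn.
have nk : (n - k = j.+1)%N by rewrite /j/= -subSn// subSS.
have mA := mF _ _ FA.
set E := _ `&` _.
have mAi i : measurable (A `&` tau j @^-1` [set i]) by apply: mF; exact: (tauF j i).
have EI i : E `&` tau j @^-1` [set i] = (A `&` tau j @^-1` [set i]) `&`
    [set w | t - g j i <= \sum_(l < n | (n - k <= l)%N) g l (tau l w)].
  have S w : \sum_(l < n | (n - k.+1 <= l)%N) g l (tau l w) =
      g j (tau j w) + \sum_(l < n | (n - k <= l)%N) g l (tau l w).
    rewrite (bigD1 j)//=; congr (_ + _); apply: eq_bigl => l.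
    by rewrite nk /= ltn_neqAle eq_sym andbC.
  rewrite /E; apply/seteqP; split => w.
    move=> [[Aw h] ti]; split => //=.
    by move: h; rewrite /= S ti lerBlDl.
  move=> [[Aw ti] h]; split => //; split => //=.
  by move: h; rewrite /= S ti lerBlDl.
have FAi i : F (n - k)%N (A `&` tau j @^-1` [set i]) by rewrite nk; exact: (tauF j i).
have IHi i := IH (ltnW kn) _ (t - g j i) (FAi i).
have mEi i : measurable (E `&` tau j @^-1` [set i]).
  by rewrite EI; have [] := IHi i.
have mE : measurable E.
  rewrite (_ : E = [set w | exists i, (E `&` tau j @^-1` [set i]) w]).
    exact: measurable_exists.
  by apply/seteqP; split=> [w Ew|w [i []]//]; exists (tau j w).
split => //; rewrite (prob_partition mE mEi).
apply: le_trans (_ : expR (- t) * (\sum_i expR (g j i) * prob (A `&` tau j @^-1` [set i])) <= _).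
  rewrite mulr_sumr; apply: ler_sum => i _; rewrite EI mulrA -expRD.
  rewrite (_ : - t + g j i = - (t - g j i)); last by rewrite opprB addrC.
  by have [] := IHi i.
by rewrite ler_wpM2l ?expR_ge0//; exact: sup.
Qed.

End RealProbability.

(** * Histories and position counts *)

Section FiniteValued.
Context d (T : measurableType d).

Lemma measurable_setbool (b : bool) : measurable ([set w | b] : set T).
Proof.
case: b.
  by rewrite (_ : [set _ | _] = setT)//; apply/seteqP; split.
by rewrite (_ : [set _ | _] = set0)//; apply/seteqP; split.
Qed.

Lemma measurable_forall (I : finType) (F : I -> set T) :
  (forall i, measurable (F i)) -> measurable [set w | forall i, F i w].
Proof.
move=> mF; have -> : [set w | forall i, F i w] = \bigcap_(i in [set: I]) F i.
  by apply/seteqP; split=> [w Fi i _|w Fi i]; apply: Fi.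
by apply: fin_bigcap_measurable => //; exact: finite_finset.
Qed.

Lemma measurable_ffun (I J : finType) (f : I -> T -> J) (y : {ffun I -> J}) :
  (forall i a, measurable (f i @^-1` [set a])) ->
  measurable [set w | [ffun i => f i w] = y].
Proof.
move=> mf; rewrite (_ : [set _ | _] = [set w | forall i, (f i @^-1` [set y i]) w]).
  exact: measurable_forall.
apply/seteqP; split => w /=; first by move=> <- i; rewrite ffunE.
by move=> h; apply/ffunP => i; rewrite ffunE.
Qed.

Lemma measurable_finset (I : finType) (p : I -> T -> bool) (S : {set I}) :
  (forall i, measurable [set w | p i w]) ->
  measurable [set w | [set i | p i w]%SET = S].
Proof.
move=> mp.
rewrite (_ : [set _ | _] = [set w | forall i, (p i w = (i \in S))]).
  apply: (@measurable_forall _ (fun i => [set w | p i w = (i \in S)])) => i.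
  case: (i \in S); first exact: mp.
  rewrite (_ : [set _ | _] = ~` [set w | p i w]); first exact: measurableC.
  by apply/seteqP; split => w /=; [move=> ->|move/negP/negbTE].
apply/seteqP; split => w /=; first by move=> <- i; rewrite inE.
by move=> h; apply/setP => i; rewrite inE.
Qed.

Lemma measurable_factor (I : finType) (f : T -> I) (Q : set I) :
  (forall i, measurable (f @^-1` [set i])) -> measurable (f @^-1` Q).
Proof.
move=> mf; rewrite (_ : _ @^-1` _ = [set w | exists i, (f @^-1` [set i] `&` [set w | `[< Q i >]]) w]).
  apply: measurable_exists => i; apply: measurableI => //.
  exact: measurable_setbool.
apply/seteqP; split => w /=.
  by move=> Qw; exists (f w); split => //; apply/asboolP.
by move=> [i [<- /asboolP]].
Qed.

End FiniteValued.

Section Histories.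
Context {R : realType} {n m : nat} {r delta : R} (M : base_model n m r delta).
Notation T := (bm_space M).
Notation pos := (@bm_pos _ _ _ _ _ M).
Notation con := (@bm_con _ _ _ _ _ M).
Notation P := (prob (bm_prob M)).
Implicit Types (A : set T) (kx kc : pred 'I_n).

Lemma sphere_pos j w : sphere (pos j w).
Proof. exact: bm_pos_sphere. Qed.

(** With the generating family named, a history is the collection of measurable sets of a type, and
    general measurability lemmas apply to it. *)
Definition generators kx kc : set (set T) :=
  [set A | (exists k, kx k /\
                 exists B : set (vec3 R), measurable B /\ A = pos k @^-1` B)
            \/ (exists k, kc k /\
                 exists i v, A = con k i @^-1` [set v])].

Notation hist kx kc := (@measurable _ (g_sigma_algebraType (generators kx kc))).

Lemma historyE kx kc : history pos con kx kc = hist kx kc.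
Proof. by []. Qed.

Lemma history_measurable kx kc A : history pos con kx kc A -> measurable A.
Proof.
apply: smallest_sub; first exact: sigma_algebra_measurable.
move=> B [[k [_ [C [mC ->]]]]|[k [_ [i [v ->]]]]].
- by rewrite -[_ @^-1` _]setTI; exact: bm_pos_measurable.
- exact: bm_con_measurable.
Qed.

Lemma sub_history kx kc kx' kc' : {subset kx <= kx'} -> {subset kc <= kc'} ->
  history pos con kx kc `<=` history pos con kx' kc'.
Proof.
move=> hx hc; apply: smallest_sub; first exact: smallest_sigma_algebra.
move=> B hB; apply: sub_gen_smallest; move: hB.
move=> [[k [kk h]]|[k [kk h]]]; [left|right]; exists k; split => //.
- exact: hx.
- exact: hc.
Qed.

Lemma history_pos kx kc k (B : set (vec3 R)) : kx k -> measurable B ->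
  history pos con kx kc (pos k @^-1` B).
Proof. by move=> kk mB; apply: sub_gen_smallest; left; exists k; split => //; exists B. Qed.

Lemma history_con kx kc k i v : kc k -> history pos con kx kc (con k i @^-1` [set v]).
Proof. by move=> kk; apply: sub_gen_smallest; right; exists k; split => //; exists i, v. Qed.

Lemma measurable_fun_pos kx kc k : kx k ->
  measurable_fun setT (pos k : g_sigma_algebraType (generators kx kc) -> vec3 R).
Proof. by move=> kk _ B mB; rewrite setTI; exact: history_pos. Qed.

(** Measurability of [acos] is bypassed: for 0 <= a < pi the event is an inequality between cosines,
    and for other values of a it is empty or everything. *)
Lemma history_angle kx kc i k a : kx i -> kx k ->
  history pos con kx kc [set w | angle (pos i w) (pos k w) <= a].
Proof.
move=> ki kk; rewrite historyE.
have [a0|a0] := ltP a 0.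
  rewrite (_ : [set _ | _] = set0); first exact: measurable0.
  apply/seteqP; split => // w /=; rewrite leNgt (lt_le_trans a0)//.
  by rewrite angle_ge0//; exact: sphere_pos.
have [pa|ap] := leP pi a.
  rewrite (_ : [set _ | _] = setT); first exact: measurableT.
  apply/seteqP; split => // w _ /=; apply: le_trans pa.
  by rewrite angle_lepi//; exact: sphere_pos.
rewrite (_ : [set _ | _] = setT `&` [set w | cos a <= cosine (pos i w) (pos k w)]).
  apply: measurable_fun_le => //.
  by apply: measurable_fun_cosine; exact: measurable_fun_pos.
rewrite setTI; apply/seteqP; split => w /=.
  by rewrite (angle_le_cos (sphere_pos _ _) (sphere_pos _ _))// a0 ltW.
by rewrite -(angle_le_cos (sphere_pos _ _) (sphere_pos _ _))// a0 ltW.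
Qed.

Lemma history_ball kx kc a u t S : (forall i : 'I_n, (i < t)%N -> kx i) -> kx u ->
  history pos con kx kc [set w | ball_vertices (pos^~ w) a (pos u w) t = S].
Proof.
move=> ht ku; rewrite historyE; apply: measurable_finset => i.
have [it|it] := ltnP i t => /=; last exact: (measurable_setbool _ false).
by apply: history_angle => //; exact: ht.
Qed.

(** A step has two stages: [before t] precedes the placing of vertex t, while [after t] knows its
    position but not yet its contacts. *)
Definition before (t : nat) := history pos con (fun k => k < t)%N (fun k => k < t)%N.
Definition after (t : nat) := history pos con (fun k => k <= t)%N (fun k => k < t)%N.

Lemma before_measurable t A : before t A -> measurable A.
Proof. exact: history_measurable. Qed.

Lemma after_measurable t A : after t A -> measurable A.
Proof. exact: history_measurable. Qed.

Lemma before_after t A : before t A -> after t A.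
Proof. by apply: sub_history => // k; apply: ltnW. Qed.

Lemma after_beforeS t A : after t A -> before t.+1 A.
Proof. by apply: sub_history => // k; apply: leqW. Qed.

Lemma before_setT t : before t setT.
Proof. by rewrite /before historyE; exact: measurableT. Qed.

Lemma beforeI t A A' : before t A -> before t A' -> before t (A `&` A').
Proof. by rewrite /before historyE; exact: measurableI. Qed.

Lemma afterI t A A' : after t A -> after t A' -> after t (A `&` A').
Proof. by rewrite /after historyE; exact: measurableI. Qed.

Lemma afterC t A : after t A -> after t (~` A).
Proof. by rewrite /after historyE; exact: measurableC. Qed.

Section PositionCounts.
Variables (B : set (vec3 R)) (mB : measurable B) (J : {set 'I_n}).

Let hit w : {set 'I_n} := [set i in J | pos i w \in B].

Lemma area_prob (j : 'I_n) : area B = (P (pos j @^-1` B))%:E.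
Proof.
have := bm_pos_law (@before_setT j) mB; rewrite probability_setT mul1e => <-.
by rewrite setTI probE// -[_ @^-1` _]setTI; exact: bm_pos_measurable.
Qed.

Lemma prob_pos (j : 'I_n) A : before j A ->
  P (A `&` pos j @^-1` B) = P A * fine (area B).
Proof.
move=> bA; have mA := before_measurable bA.
have a0 : area B \is a fin_num by rewrite (area_prob j).
by rewrite /prob (bm_pos_law bA mB) fineM// fin_num_measure.
Qed.

(** A position is independent of the past, so the left-hand side of the hypothesis is the
    conditional exponential moment of one score; vertices outside J score 0. *)
Lemma position_score_tail (g : bool -> R) :
  expR (g true) * fine (area B) + expR (g false) * (1 - fine (area B)) <= 1 ->
  forall t, let E := [set w | t <= \sum_(j in J) g (pos j w \in B)] in
  measurable E /\ P E <= expR (- t).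
Proof.
move=> hg t /=; pose hitB (j : 'I_n) w := pos j w \in B.
have preim (j : 'I_n) (b : bool) :
    hitB j @^-1` [set b] = if b then pos j @^-1` B else ~` (pos j @^-1` B).
  apply/seteqP; split => w /=; case: b => /=.
  - by move/set_mem.
  - by move=> h /mem_set; rewrite -/(hitB j w) h.
  - by move/mem_set.
  - by move=> h; apply/negbTE/negP => /set_mem.
have hitF (j : 'I_n) b A : before j A -> before j.+1 (A `&` hitB j @^-1` [set b]).
  move=> bA; rewrite preim; apply: beforeI; first exact: (after_beforeS (before_after bA)).
  have bB : before j.+1 (pos j @^-1` B) by exact: (history_pos (ltnSn j) mB).
  by case: b => //; move: bB; rewrite /before historyE; exact: measurableC.
pose h (j : 'I_n) b := if j \in J then g b else 0.
have sup (j : 'I_n) A : before j A ->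
    \sum_b expR (h j b) * P (A `&` hitB j @^-1` [set b]) <= P A.
  move=> bA; have mA := before_measurable bA.
  rewrite big_bool /= !preim prob_pos//.
  have -> : P (A `&` ~` (pos j @^-1` B)) = P A * (1 - fine (area B)).
    have mpB : measurable (pos j @^-1` B).
      by rewrite -[_ @^-1` _]setTI; exact: bm_pos_measurable.
    have mX b : measurable (A `&` hitB j @^-1` [set b]).
      by rewrite preim; case: b; apply: measurableI => //; exact: measurableC.
    have := prob_partition (bm_prob M) mA mX; rewrite big_bool /= !preim prob_pos// => E.
    by lra.
  rewrite /h; case: ifP => _; last by rewrite expR0; lra.
  have := prob_ge0 (bm_prob M) A; move: (P A) hg => p; nra.
have := adaptive_tail before_measurable hitF sup t (@before_setT 0).
rewrite setTI /h; under eq_set => w do rewrite -big_mkcond/=.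
by rewrite /prob probability_setT mulr1.
Qed.

Lemma sum_hit w : \sum_(j in J) (pos j w \in B)%:R = #|hit w|%:R :> R.
Proof.
rewrite -natr_sum -sum1_card; congr (_%:R).
by rewrite [RHS]big_mkcond/= [LHS]big_mkcond/=; apply: eq_bigr => j _;
  rewrite !inE; case: (j \in J); case: (pos j w \in B).
Qed.

Lemma expRN1_le : expR (-1) <= 1 / 2 :> R.
Proof.
have := @expR_ge1Dx R 1; have := @expR_gt0 R 1.
by rewrite expRN div1r lef_pV2 ?posrE//; lra.
Qed.

(** The score is a / 2 minus the hit indicator. Since e^-1 <= 1/2, its exponential moment is at most
    e^(a/2) (1 - a / 2) <= 1. The vertex [j0] identifies the area as a probability, through the law
    of its position. *)
Lemma few_hits (j0 : 'I_n) a : 0 <= a -> (a%:E <= area B)%E ->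
  let E := [set w | #|hit w|%:R <= a * #|J|%:R / 4] in
  measurable E /\ P E <= expR (- (a * #|J|%:R / 4)).
Proof.
move=> a0 aB; have := @position_score_tail (fun b => a / 2 - b%:R) _ (a * #|J|%:R / 4).
have [] := (aB, area_prob j0); case: (area B) => // al; rewrite lee_fin => {}aB _.
case=> [/=|mE PE].
  have := expRN1_le; have := @expR_ge1Dx R (- (a / 2)).
  rewrite subr0 expRD expRN => h1 h2.
  have e0 := @expR_gt0 R (a / 2).
  apply: le_trans (_ : expR (a / 2) * (1 - a / 2) <= _).
    rewrite -mulrA -mulrDr ler_pM2l//.
    by have : al * expR (-1) <= al * (1 / 2); [rewrite ler_wpM2l//|]; lra.
  by rewrite -ler_pdivlMl// mulr1; lra.
move=> E; rewrite (_ : E = [set w | a * #|J|%:R / 4 <=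
    \sum_(j in J) (a / 2 - (pos j w \in B)%:R)]) //.
apply/seteqP; rewrite /E; split => w /=;
  by rewrite sumrB sumr_const -mulr_natr sum_hit; lra.
Qed.

(** The score is the hit indicator minus 3a. Since e <= 4, its exponential moment is at most e^(-3a)
    (1 + 3a) <= 1. *)
Lemma many_hits (j0 : 'I_n) a : (area B <= a%:E)%E ->
  let E := [set w | 4 * a * #|J|%:R <= #|hit w|%:R] in
  measurable E /\ P E <= expR (- (a * #|J|%:R)).
Proof.
move=> aB; have := @position_score_tail (fun b => b%:R - 3 * a) _ (a * #|J|%:R).
have ar0 : (0 <= area B)%E by rewrite (area_prob j0) lee_fin prob_ge0.
have [] := (aB, area_prob j0); case: (area B) ar0 => // al.
rewrite !lee_fin => al0 {}aB _.
case=> [/=|mE PE].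
  have e0 := @expR_gt0 R (- (3 * a)).
  have e4 : expR 1 <= 4 :> R.
    have := @expR_ge1Dx R (- (1 / 2)); rewrite expRN => h.
    have e2 := @expR_gt0 R (1 / 2).
    have : expR (1 / 2) <= 2 :> R.
      rewrite -[leRHS]invrK -[leLHS]invrK lef_pV2 ?posrE ?invr_gt0//.
      by apply: le_trans h; lra.
    rewrite (_ : expR 1 = expR (1 / 2) * expR (1 / 2)); last first.
      by rewrite -expRD; congr expR; lra.
    by move=> ?; nra.
  rewrite sub0r expRD; have := @expR_ge1Dx R (3 * a) => h1.
  apply: le_trans (_ : expR (- (3 * a)) * (1 + 3 * a) <= _).
    rewrite [expR 1 * _]mulrC -mulrA -mulrDr ler_pM2l//.
    have : expR 1 * al <= 4 * al by rewrite ler_wpM2r.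
    by lra.
  by rewrite expRN -ler_pdivlMl ?invr_gt0 ?expR_gt0// invrK mulr1.
move=> E; rewrite (_ : E = [set w | a * #|J|%:R <=
    \sum_(j in J) ((pos j w \in B)%:R - 3 * a)]) //.
apply/seteqP; rewrite /E; split => w /=;
  by rewrite sumrB sumr_const -mulr_natr sum_hit; lra.
Qed.

End PositionCounts.
End Histories.

(** * Contacts *)

Section ContactProb.
Context {R : realType} {n m : nat} (r delta : R).
Implicit Types (pos : 'I_n -> vec3 R) (con : 'I_n -> 'I_m -> 'I_n).

Lemma new_edges_ext pos con pos' con' (j : 'I_n) :
  ball_vertices pos r (pos j) j = ball_vertices pos' r (pos' j) j ->
  con j =1 con' j -> new_edges r pos con j = new_edges r pos' con' j.
Proof.
by move=> hb hc; rewrite /new_edges hb; case: ifP => // _; apply: eq_map => i; rewrite hc.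
Qed.

Lemma graph_at_ext pos con pos' con' t :
  (forall k : 'I_n, (k < t)%N ->
    ball_vertices pos r (pos k) k = ball_vertices pos' r (pos' k) k) ->
  (forall k : 'I_n, (k < t)%N -> con k =1 con' k) ->
  graph_at r pos con t = graph_at r pos' con' t.
Proof.
move=> hb hc; rewrite /graph_at; congr flatten; apply/eq_in_map => k.
by rewrite mem_filter => /andP[kt _]; apply: new_edges_ext; [exact: hb|exact: hc].
Qed.

Lemma contact_prob_ext pos con pos' con' (j v : 'I_n) :
  (forall k : 'I_n, (k <= j)%N ->
    ball_vertices pos r (pos k) k = ball_vertices pos' r (pos' k) k) ->
  (forall k : 'I_n, (k < j)%N -> con k =1 con' k) ->
  contact_prob r delta pos con j v = contact_prob r delta pos' con' j v.
Proof.
move=> hb hc; rewrite /contact_prob (hb j (leqnn _)).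
by rewrite (@graph_at_ext pos con pos' con')// => k kj; apply: hb; exact: ltnW.
Qed.

Variables (pos : 'I_n -> vec3 R) (con : 'I_n -> 'I_m -> 'I_n) (j : 'I_n).
Hypothesis delta_gt0 : 0 < delta.
Notation nearby := (ball_vertices pos r (pos j) j).
Notation cp := (contact_prob r delta pos con j).

Lemma contact_prob_ge0 v : 0 <= cp v.
Proof.
rewrite /contact_prob; case: ifP => // _.
by rewrite divr_ge0 ?sumr_ge0// => *; rewrite addr_ge0// ltW.
Qed.

Lemma contact_prob_notin v : v \notin nearby -> cp v = 0.
Proof. by rewrite /contact_prob => /negbTE->. Qed.

Lemma sum_contact_prob_near : nearby != finset.set0 -> \sum_(v in nearby) cp v = 1.
Proof.
move=> /set0Pn[u un].
rewrite (eq_bigr (fun v => ((deg (graph_at r pos con j) v)%:R + delta) /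
   \sum_(w in nearby) ((deg (graph_at r pos con j) w)%:R + delta))); last first.
  by move=> v vn; rewrite /contact_prob vn.
rewrite -mulr_suml divff// gt_eqF// (bigD1 u)//= ltr_wpDr//.
  by rewrite sumr_ge0// => *; rewrite addr_ge0// ltW.
by rewrite ltr_wpDl.
Qed.

Lemma sum_contact_prob : nearby != finset.set0 -> \sum_v cp v = 1.
Proof.
move=> n0; rewrite -(sum_contact_prob_near n0) [RHS]big_mkcond; apply: eq_bigr => v _.
by case: ifP => // /negbT; exact: contact_prob_notin.
Qed.

(** The Laplace transform of a binomial variable: among m independent contacts each falls into S
    with the same probability. *)
Lemma sum_exp_contacts (S : {set 'I_n}) (l : R) : nearby != finset.set0 ->
  \sum_(c : {ffun 'I_m -> 'I_n})
    expR (- l * #|[set i | c i \in S]%SET|%:R) * \prod_i cp (c i) =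
  (1 - (1 - expR (- l)) * \sum_(v in S) cp v) ^+ m.
Proof.
move=> n0; pose F (i : 'I_m) v := expR (- l * (v \in S)%:R) * cp v.
transitivity (\prod_(i < m) \sum_v F i v).
  rewrite bigA_distr_bigA/=; apply: eq_bigr => c _.
  rewrite big_split/= -expR_sum -mulr_sumr -natr_sum -sum1_card; congr (expR (_ * _%:R) * _).
  by rewrite big_mkcond/=; apply: eq_bigr => i _; rewrite inE; case: (_ \in S).
rewrite /F big_const_ord iter_mulr_1; congr (_ ^+ _).
rewrite -[X in _ = X - _](sum_contact_prob n0) [\sum_(v in S) _]big_mkcond mulr_sumr -sumrB.
apply: eq_bigr => v _; case: ifP => _; first by rewrite mulr1; ring.
by rewrite !mulr0 expR0 mul1r subr0.
Qed.

End ContactProb.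

(** * Conditional law of the contacts of a vertex, and its tail bounds *)

Section ContactStep.
Context {R : realType} {n m : nat} {r delta : R} (M : base_model n m r delta).
Hypothesis delta_gt0 : 0 < delta.
Notation T := (bm_space M).
Notation pos := (@bm_pos _ _ _ _ _ M).
Notation con := (@bm_con _ _ _ _ _ M).
Notation P := (prob (bm_prob M)).
Implicit Types (A : set T).

Definition nearby (j : 'I_n) w := ball_vertices (pos^~ w) r (pos j w) j.

Definition cprob (j : 'I_n) w v :=
  contact_prob r delta (pos^~ w) (fun k l => con k l w) j v.

Definition contacts_in (j : 'I_n) (X : T -> {set 'I_n}) w : nat :=
  #|[set i | con j i w \in X w]%SET|.

(** All that the law of the contacts of j depends on, as a value in a finite type: positions enter
    only through neighbour sets. Indices that are not yet known receive dummy values. *)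
Definition past (j : 'I_n) w :
    {ffun 'I_n -> {set 'I_n}} * {ffun 'I_n -> {ffun 'I_m -> 'I_n}} :=
  ([ffun k : 'I_n => if (k <= j)%N then ball_vertices (pos^~ w) r (pos k w) k
                     else finset.set0],
   [ffun k : 'I_n => [ffun i => if (k < j)%N then con k i w else j]]).

Lemma past_eq j w w' : past j w = past j w' ->
  nearby j w = nearby j w' /\ cprob j w =1 cprob j w'.
Proof.
case=> /ffunP h1 /ffunP h2.
have hb (k : 'I_n) : (k <= j)%N -> ball_vertices (pos^~ w) r (pos k w) k =
    ball_vertices (pos^~ w') r (pos k w') k.
  by move=> kj; have := h1 k; rewrite !ffunE kj.
split; first exact: hb.
move=> v; apply: contact_prob_ext => // k kj i.
by have /ffunP /(_ i) := h2 k; rewrite !ffunE kj.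
Qed.

Lemma after_past (j : 'I_n) s : after j (past j @^-1` [set s]).
Proof.
case: s => s1 s2.
pose f1 (k : 'I_n) w := if (k <= j)%N then ball_vertices (pos^~ w) r (pos k w) k
                     else finset.set0.
pose f2 (k : 'I_n) w := [ffun i => if (k < j)%N then con k i w else j].
rewrite (_ : _ @^-1` _ = [set w | [ffun k => f1 k w] = s1] `&` [set w | [ffun k => f2 k w] = s2]).
  apply: afterI; rewrite /after historyE; apply: measurable_ffun => k a.
    rewrite /f1; have [kj|kj] := leqP k j.
      by apply: history_ball => // i ik; exact: leq_trans (ltnW ik) kj.
    rewrite (_ : _ @^-1` _ = [set w | finset.set0 == a]); first exact: measurable_setbool.
    by apply/seteqP; split => w /= /eqP.
  rewrite /f2; apply: measurable_ffun => i v.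
  have [kj|kj] := ltnP k j; first exact: history_con.
  rewrite (_ : _ @^-1` _ = [set w | j == v]); first exact: measurable_setbool.
  by apply/seteqP; split => w /= /eqP.
by apply/seteqP; split => w /=; [case=> <- <-|case=> [<- <-]].
Qed.

(** Such a Q is a finite union of fibres of the pair of [past j] and f, each of which belongs to
    [after j]. This settles the measurability of the guards. *)
Lemma after_event (I : finType) (f : T -> I) (j : 'I_n) (Q : set T) :
  (forall i, after j (f @^-1` [set i])) ->
  (forall w w', past j w = past j w' -> f w = f w' -> Q w -> Q w') -> after j Q.
Proof.
move=> af hQ; pose g w := (past j w, f w).
rewrite (_ : Q = g @^-1` (g @` Q)).
  rewrite /after historyE; apply: measurable_factor => -[s i].
  rewrite (_ : _ @^-1` _ = past j @^-1` [set s] `&` f @^-1` [set i]).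
    by apply: afterI => //; exact: after_past.
  by apply/seteqP; split => w /=; [case=> <- <-|case=> <- <-].
apply/seteqP; split => [w Qw|w [w' Qw' e]]; first by exists w.
by apply: hQ Qw'; [exact: (congr1 fst e)|exact: (congr1 snd e)].
Qed.

Lemma before_contacts (j : 'I_n) (c : 'I_m -> 'I_n) :
  before j.+1 [set w | forall i, con j i w = c i].
Proof.
rewrite /before historyE.
apply: (@measurable_forall _ (g_sigma_algebraType (generators (M:=M) _ _)) _
  (fun i => [set w | con j i w = c i])) => i.
exact: history_con.
Qed.

Lemma before_contacts_in (j : 'I_n) X (a : nat) :
  (forall S, after j (X @^-1` [set S])) ->
  before j.+1 [set w | contacts_in j X w = a].
Proof.
move=> hX; pose Z w := ([ffun i => con j i w], X w).
pose Q := [set z : {ffun 'I_m -> 'I_n} * {set 'I_n} | #|[set i | z.1 i \in z.2]%SET| = a].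
rewrite (_ : [set _ | _] = Z @^-1` Q).
  rewrite /before historyE; apply: measurable_factor => -[c S].
  rewrite (_ : _ @^-1` _ = [set w | [ffun i => con j i w] = c] `&` X @^-1` [set S]).
    apply: beforeI; last exact: after_beforeS.
    rewrite /before historyE; apply: measurable_ffun => i v; exact: history_con.
  by apply/seteqP; split => w /=; [case=> <- <-|case=> <- <-].
apply/seteqP; split => w; rewrite /Q /Z /contacts_in /= => <-.
  by apply: eq_card => i; rewrite !inE ffunE.
by apply: eq_card => i; rewrite !inE ffunE.
Qed.

(** Where the past is constant, so is the integrand in [bm_con_law], and the integral becomes a
    product. *)
Lemma contact_law (j : 'I_n) A w0 (c : 'I_m -> 'I_n) : after j A -> A w0 ->
  (forall w, A w -> past j w = past j w0) -> nearby j w0 != finset.set0 ->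
  P (A `&` [set w | forall i, con j i w = c i]) = \prod_i cprob j w0 (c i) * P A.
Proof.
move=> aA Aw0 pA n0; have mA := after_measurable aA.
have mC : measurable [set w | forall i, con j i w = c i].
  by apply: before_measurable; exact: before_contacts.
apply: EFin_inj; rewrite -probE; last exact: measurableI.
rewrite bm_con_law//; last first.
  by move=> w /pA/past_eq[e _]; rewrite -[ball_vertices _ _ _ _]/(nearby j w) e.
rewrite EFinM -probE// -integral_cst//; apply: eq_integral => w /set_mem Aw.
by congr EFin; apply: eq_bigr => i _; have [_ e] := past_eq (pA _ Aw); exact: e.
Qed.

(** The conditional Laplace transform of one step with a random target X. Splitting A by the past
    and by the value of X, then by the vector of contacts, reduces it to [sum_exp_contacts]; the
    transform decreases in the success probability, so q may replace it. *)
Lemma contact_step (j : 'I_n) A (X : T -> {set 'I_n}) (q l : R) : after j A ->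
  (forall S, after j (X @^-1` [set S])) -> 0 <= l ->
  (forall w, A w -> nearby j w != finset.set0 /\ q <= \sum_(v in X w) cprob j w v) ->
  \sum_(a < m.+1) expR (- l * a%:R) * P (A `&` [set w | contacts_in j X w = a]) <=
    (1 - (1 - expR (- l)) * q) ^+ m * P A.
Proof.
move=> aA hX l0 hA; have mA := after_measurable aA.
pose Y w := (past j w, X w).
have aY y : after j (Y @^-1` [set y]).
  case: y => s S; rewrite (_ : _ @^-1` _ = past j @^-1` [set s] `&` X @^-1` [set S]).
    by apply: afterI; [exact: after_past|exact: hX].
  by apply/seteqP; split => w /=; [case=> <- <-|case=> <- <-].
have mY y := after_measurable (aY y).
have mN a : measurable [set w | contacts_in j X w = a].
  by apply: before_measurable; exact: before_contacts_in.
have mAN a : measurable (A `&` [set w | contacts_in j X w = a]) by exact: measurableI.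
rewrite (eq_bigr (fun a : 'I_m.+1 => \sum_y expR (- l * a%:R) *
    P ((A `&` Y @^-1` [set y]) `&` [set w | contacts_in j X w = a]))); last first.
  move=> a _; rewrite (@prob_partition _ _ _ _ _ Y)// => [|y]; last exact: measurableI.
  by rewrite mulr_sumr; apply: eq_bigr => y _; rewrite setIAC.
rewrite exchange_big/= (@prob_partition _ _ _ _ _ Y A)// => [|y]; last exact: measurableI.
rewrite mulr_sumr; apply: ler_sum => y _.
have aAy : after j (A `&` Y @^-1` [set y]) by exact: afterI.
set A' := A `&` _ in aAy *; have mA' := after_measurable aAy.
have [->|/set0P[w0 Aw0]] := eqVneq A' set0.
  by rewrite prob_set0 mulr0 big1// => a _; rewrite set0I prob_set0 mulr0.
have [n0 qX] := hA _ Aw0.1.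
have YA w : A' w -> past j w = past j w0 /\ X w = X w0.
  move=> [_ Yw]; have [_ Yw0] := Aw0.
  have e : Y w = Y w0 := etrans Yw (esym Yw0).
  by split; [exact: (congr1 fst e)|exact: (congr1 snd e)].
pose Z w := [ffun i => con j i w].
have ZE c : Z @^-1` [set c] = [set w | forall i, con j i w = c i].
  apply/seteqP; split => w /=; first by move=> <- i; rewrite ffunE.
  by move=> h; apply/ffunP => i; rewrite ffunE.
have mZ c : measurable (Z @^-1` [set c]).
  by rewrite ZE; apply: before_measurable; exact: before_contacts.
have NZ (c : {ffun 'I_m -> 'I_n}) w : A' w -> Z w = c ->
    contacts_in j X w = #|[set i | c i \in X w0]%SET|.
  move=> Aw <-; have [_ XE] := YA _ Aw; apply: eq_card => i.
  by rewrite !inE ffunE XE.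
rewrite (eq_bigr (fun a : 'I_m.+1 => \sum_(c : {ffun 'I_m -> 'I_n})
    (a == #|[set i | c i \in X w0]%SET| :> nat)%:R *
    (expR (- l * a%:R) * P (A' `&` Z @^-1` [set c])))); last first.
  move=> a _; rewrite (@prob_partition _ _ _ _ _ Z)//; first last.
    by move=> c; apply: measurableI => //; exact: measurableI.
    exact: measurableI.
  rewrite mulr_sumr; apply: eq_bigr => c _.
  have [ac|ac] := eqVneq.
    rewrite mul1r; congr (_ * P _); apply/seteqP; split => w [].
      by move=> [].
    by move=> Aw Zw; split => //; split => //=; rewrite (NZ _ _ Aw Zw) ac.
  rewrite mul0r (_ : _ `&` _ = set0) ?prob_set0 ?mulr0//.
  apply/seteqP; split => // w [[Aw Nw] Zw]; move/eqP: ac; apply.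
  by rewrite -(NZ _ _ Aw Zw).
rewrite exchange_big/= (eq_bigr (fun c : {ffun 'I_m -> 'I_n} => P A' *
   (expR (- l * #|[set i | c i \in X w0]%SET|%:R) * \prod_i cprob j w0 (c i)))); last first.
  move=> c _; have cm : (#|[set i | c i \in X w0]%SET| < m.+1)%N.
    by rewrite ltnS (leq_trans (max_card _))// card_ord.
  rewrite (bigD1 (Ordinal cm))//= eqxx mul1r big1 ?addr0.
    rewrite ZE (contact_law _ aAy Aw0)//; first by rewrite mulrA mulrC.
    by move=> w /YA[].
  by move=> a; rewrite -val_eqE /= => /negbTE->; rewrite mul0r.
rewrite -mulr_sumr mulrC ler_wpM2r ?prob_ge0// sum_exp_contacts//.
have S1 : \sum_(v in X w0) cprob j w0 v <= 1.
  rewrite -(sum_contact_prob (fun k l => con k l w0) delta_gt0 n0) big_mkcond/=; apply: ler_sum => v _.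
  by case: ifP => // _; exact: contact_prob_ge0.
have S0 : 0 <= \sum_(v in X w0) cprob j w0 v.
  by rewrite sumr_ge0// => v _; exact: contact_prob_ge0.
have e0 := @expR_gt0 R (- l).
have e1 : expR (- l) <= 1 by rewrite expR_le1; lra.
apply: lerXn2r; rewrite ?nnegrE.
- by move: S0 S1; rewrite /cprob; move: (\sum_(v in _) _) => S S0 S1; nra.
- by move: S0 S1 qX; rewrite /cprob; move: (\sum_(v in _) _) => S S0 S1 qX; nra.
- by rewrite lerD2l lerN2 ler_wpM2l//; lra.
Qed.

(** The guard [G j] is known before the contacts of j are drawn, and a step where it fails scores 0.
    Hence nothing has to be assumed about how often the success probability reaches q. *)
Lemma contacts_tail (J : {set 'I_n}) (G : 'I_n -> T -> bool)
    (X : 'I_n -> T -> {set 'I_n}) (q l mu t : R) :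
  0 <= l -> expR mu * (1 - (1 - expR (- l)) * q) ^+ m <= 1 ->
  (forall (j : 'I_n) S, after j (X j @^-1` [set S])) ->
  (forall j : 'I_n, after j [set w | G j w]) ->
  (forall j w, G j w ->
    nearby j w != finset.set0 /\ q <= \sum_(v in X j w) cprob j w v) ->
  let E := [set w | t <= \sum_(j in J | G j w)
    (mu - l * (contacts_in j (X j) w)%:R)] in
  measurable E /\ P E <= expR (- t).
Proof.
move=> l0 hmu hX hG hGX /=.
pose tau (j : 'I_n) w : bool * 'I_m.+1 :=
  ((j \in J) && G j w, inord (contacts_in j (X j) w)).
pose h (j : 'I_n) (z : bool * 'I_m.+1) := if z.1 then mu - l * z.2%:R else 0.
have cm (j : 'I_n) w : (contacts_in j (X j) w < m.+1)%N.
  by rewrite ltnS (leq_trans (max_card _))// card_ord.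
have aJ (j : 'I_n) b : after j [set w | ((j \in J) && G j w) = b].
  have aG : after j [set w | (j \in J) && G j w].
    case: (j \in J) => /=; first exact: hG.
    rewrite /after historyE; exact: (measurable_setbool _ false).
  case: b; first exact: aG.
  rewrite (_ : [set _ | _] = ~` [set w | (j \in J) && G j w]); first exact: afterC.
  by apply/seteqP; split => w /=; [move=> ->|move/negP/negbTE].
have tauE (j : 'I_n) b (a : 'I_m.+1) : tau j @^-1` [set (b, a)] =
    [set w | ((j \in J) && G j w) = b] `&` [set w | contacts_in j (X j) w = a].
  apply/seteqP; split => w; rewrite /tau /=.
    by case=> <- /(congr1 val); rewrite /= inordK.
  by case=> <- e; congr pair; apply: val_inj; rewrite /= inordK.
have tauF (j : 'I_n) z A : before j A -> before j.+1 (A `&` tau j @^-1` [set z]).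
  case: z => b a bA; rewrite tauE; apply: beforeI.
    exact: (after_beforeS (before_after bA)).
  apply: beforeI; first exact: after_beforeS.
  by apply: before_contacts_in => S; exact: hX.
have sup (j : 'I_n) A : before j A ->
    \sum_z expR (h j z) * P (A `&` tau j @^-1` [set z]) <= P A.
  move=> bA; have mA := before_measurable bA.
  have mN a : measurable [set w | contacts_in j (X j) w = a].
    by apply: before_measurable; apply: before_contacts_in => S; exact: hX.
  have mJ b := after_measurable (aJ j b).
  rewrite (eq_bigr (fun z => expR (h j (z.1, z.2)) * P (A `&` tau j @^-1` [set (z.1, z.2)])));
    last by case.
  rewrite -(pair_bigA _ (fun b a => expR (h j (b, a)) * P (A `&` tau j @^-1` [set (b, a)])))/=.
  rewrite (prob_partition (bm_prob M) (X := fun w => (j \in J) && G j w) mA); last first.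
    by move=> b; apply: measurableI => //; exact: mJ.
  apply: ler_sum => b _.
  set A' := A `&` _; have aA' : after j A'.
    by apply: afterI; [exact: before_after|exact: aJ].
  have mA' := after_measurable aA'.
  rewrite (eq_bigr (fun a : 'I_m.+1 =>
    expR (h j (b, a)) * P (A' `&` [set w | contacts_in j (X j) w = a]))); last first.
    by move=> a _; rewrite tauE setIA.
  case: b @A' aA' mA' => /= aA' mA'; last first.
    rewrite [leRHS](prob_partition (bm_prob M)
      (X := fun w => inord (contacts_in j (X j) w) : 'I_m.+1))//; last first.
      move=> a; apply: measurableI => //.
      rewrite (_ : _ @^-1` _ = [set w | contacts_in j (X j) w = a])//.
      apply/seteqP; split => w /=; first by move=> <-; rewrite inordK.
      by move=> e; apply: val_inj; rewrite /= inordK.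
    apply: ler_sum => a _; rewrite /h /= expR0 mul1r.
    rewrite (_ : (fun w => inord (contacts_in j (X j) w)) @^-1` [set a] =
      [set w | contacts_in j (X j) w = a])//.
    apply/seteqP; split => w /=; first by move=> <-; rewrite inordK.
    by move=> e; apply: val_inj; rewrite /= inordK.
  have st := contact_step aA' (hX j) l0.
  rewrite (eq_bigr (fun a : 'I_m.+1 => expR mu * (expR (- l * a%:R) *
     P ((A `&` (fun w => (j \in J) && G j w) @^-1` [set true]) `&`
       [set w | contacts_in j (X j) w = a])))); last first.
    by move=> a _; rewrite /h /= expRD mulrA mulNr.
  rewrite -mulr_sumr.
  apply: (@le_trans _ _ (expR mu * ((1 - (1 - expR (- l)) * q) ^+ m *
     P (A `&` (fun w => (j \in J) && G j w) @^-1` [set true])))).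
    rewrite ler_wpM2l ?expR_ge0//; apply: st => w [_ /= /andP[_ Gw]]; exact: hGX.
  by rewrite mulrA ler_piMl// prob_ge0.
have := adaptive_tail (@before_measurable _ _ _ _ _ M) tauF sup t (@before_setT _ _ _ _ _ M 0).
rewrite setTI {2}/prob probability_setT mulr1.
rewrite (_ : [set w | t <= \sum_(j < n) h j (tau j w)] =
  [set w | t <= \sum_(j in J | G j w) (mu - l * (contacts_in j (X j) w)%:R)])//.
have hS w : \sum_(j < n) h j (tau j w) =
    \sum_(j in J | G j w) (mu - l * (contacts_in j (X j) w)%:R).
  by rewrite [RHS]big_mkcond/=; apply: eq_bigr => j _; rewrite /h /= inordK.
by apply/seteqP; split => w /=; rewrite hS.
Qed.

End ContactStep.

(** * Volumes and cuts *)

Section Multigraphs.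
Variables (V : finType).
Implicit Types (G : multigraph V) (A : {set V}).

Lemma cutC G A : Defs.cut G (~: A) = Defs.cut G A.
Proof. by apply: eq_count => e; rewrite !inE addbN addNb negbK. Qed.

Lemma sum_or_le (A : {set V}) (e : V * V) :
  (\sum_(v in A) ((e.1 == v) || (e.2 == v)) <= (e.1 \in A) + (e.2 \in A))%N.
Proof.
have h (x : V) : (\sum_(v in A) (x == v) = (x \in A))%N.
  rewrite big_mkcond (bigD1 x)//= eqxx big1 ?addn0; first by case: (x \in A).
  by move=> v; rewrite eq_sym => /negbTE->; case: ifP.
rewrite -!h -big_split/=; apply: leq_sum => v _.
by case: (e.1 == v); case: (e.2 == v).
Qed.

Lemma vol_touch G A :
  (vol G A <= 2 * count (fun e => (e.1 \in A) || (e.2 \in A)) G)%N.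
Proof.
rewrite /vol; elim: G => [|e G IH]; first by rewrite big1.
rewrite /deg /= big_split/= mulnDr leq_add//; apply: leq_trans (sum_or_le _ _) _.
by case: (e.1 \in A); case: (e.2 \in A).
Qed.

(** An edge that touches A with its source outside A lies in the cut. Volumes are thus controlled by
    the number of edges sent, although in-degrees are not bounded. *)
Lemma vol_source G A :
  (vol G A <= 2 * count (fun e => e.1 \in A) G + Defs.cut G A)%N.
Proof.
rewrite /vol /Defs.cut; elim: G => [|e G IH]; first by rewrite big1.
rewrite /deg /= big_split/= mulnDr addnACA leq_add//; apply: leq_trans (sum_or_le _ _) _.
by case: (e.1 \in A); case: (e.2 \in A).
Qed.

End Multigraphs.

Section GraphAt.
Context {R : realType} {n m : nat} (r : R).
Variables (pos : 'I_n -> vec3 R) (con : 'I_n -> 'I_m -> 'I_n).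
Notation near j := (ball_vertices pos r (pos j) j).
Notation E := (new_edges r pos con).
Notation G := (graph_at r pos con).
Implicit Types (A S : {set 'I_n}) (j u v : 'I_n) (t : nat).

Lemma count_graph_at (p : pred ('I_n * 'I_n)) t :
  count p (G t) = (\sum_(j < n | (j < t)%N) count p (E j))%N.
Proof.
rewrite /graph_at count_flatten -map_comp sumnE big_map big_filter.
by rewrite big_enum_cond.
Qed.

Lemma size_new_edges j : (m <= size (E j) <= 2 * m)%N.
Proof.
rewrite /new_edges; case: ifP => _; first by rewrite size_nseq mul2n -addnn leq_addr leqnn.
by rewrite size_map size_enum_ord mul2n -addnn leq_addr leqnn.
Qed.

Lemma new_edges_source j e : e \in E j -> e.1 = j.
Proof.
rewrite /new_edges; case: ifP => _; first by rewrite mem_nseq => /andP[_ /eqP->].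
by move=> /mapP[i _ ->].
Qed.

Lemma deg_graph_at t j : (j < t)%N -> (m <= deg (G t) j)%N.
Proof.
move=> jt; rewrite /deg count_graph_at (bigD1 j)//=.
apply: leq_trans (leq_addr _ _); case/andP: (size_new_edges j) => h _.
apply: leq_trans h _; rewrite -count_predT leq_eqVlt; apply/orP; left; apply/eqP.
by apply: eq_in_count => e /new_edges_source <-; rewrite eqxx.
Qed.

Lemma vol_ge A : (m * #|A| <= vol (G n) A)%N.
Proof.
rewrite /vol -sum1_card big_distrr/=; apply: leq_sum => v _.
by rewrite muln1 deg_graph_at.
Qed.

Lemma vol_le A : (vol (G n) A <= 4 * m * #|A| + Defs.cut (G n) A)%N.
Proof.
apply: leq_trans (vol_source _ _) _; rewrite leq_add2r count_graph_at.
rewrite (_ : 4 * m * #|A| = 2 * (\sum_(j in A) 2 * m))%N; last first.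
  by rewrite sum_nat_const [(#|_| * _)%N]mulnC !mulnA.
rewrite leq_mul2l/= [leqRHS]big_mkcond/= big_mkcond/=; apply: leq_sum => j _.
rewrite ltn_ord; case/andP: (size_new_edges j) => _ h.
have [jA|jA] := boolP (j \in A); first exact: leq_trans (count_size _ _) h.
rewrite leqn0 (eq_in_count (a2 := pred0)) ?count_pred0// => e /new_edges_source ->.
exact: negbTE.
Qed.

Lemma count_new_edges (p : pred ('I_n * 'I_n)) j : near j != finset.set0 ->
  count p (E j) = #|[set i | p (j, con j i)]%SET|.
Proof.
rewrite /new_edges => /negbTE->; rewrite count_map -sum1_count big_enum_cond/=.
by rewrite -sum1_card; apply: eq_bigl => i; rewrite inE.
Qed.

Lemma count_loops (p : pred ('I_n * 'I_n)) j : near j = finset.set0 ->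
  count p (E j) = (p (j, j) * (2 * m))%N.
Proof. by rewrite /new_edges => ->; rewrite eqxx count_nseq. Qed.

Lemma sum_card_contacts j A :
  (\sum_(u in A) #|[set i | con j i == u]%SET| = #|[set i | con j i \in A]%SET|)%N.
Proof.
rewrite -sum1_card big_mkcond/=.
rewrite (eq_bigr (fun u => \sum_i (u \in A) && (con j i == u) : nat)%N); last first.
  move=> u _; case: (u \in A) => /=; last by rewrite big1.
  by rewrite -sum1_card big_mkcond; apply: eq_bigr => i _; rewrite inE; case: eqP.
rewrite exchange_big [RHS]big_mkcond; apply: eq_bigr => i _; rewrite inE.
rewrite (bigD1 (con j i))//= eqxx andbT big1 ?addn0; first by case: (_ \in A).
by move=> u; rewrite eq_sym => /negbTE->; rewrite andbF.
Qed.

(** The first sum counts edges sent from A to S, the second edges sent from S to A; their sources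
    lie in disjoint sets, so no edge is counted twice. Isolated sources are excluded because their
    [con] values are not edges. *)
Lemma cut_ge A S (h : nat) : (forall j, j \in A -> j \notin S) ->
  (\sum_(j in A | (h <= j)%N && (near j != finset.set0)) #|[set i | con j i \in S]%SET| +
   \sum_(u in A | (u < h)%N) \sum_(j in S | (h <= j)%N && (near j != finset.set0))
     #|[set i | con j i == u]%SET| <= Defs.cut (G n) A)%N.
Proof.
move=> dAS; rewrite /Defs.cut count_graph_at (exchange_big_dep
  (fun j => (j \in S) && ((h <= j)%N && (near j != finset.set0))))//=.
rewrite big_mkcond [X in (_ + X)%N]big_mkcond -big_split/= [leqRHS]big_mkcond.
apply: leq_sum => j _; rewrite ltn_ord.
have [/andP[hj nj]|_] := boolP ((h <= j)%N && (near j != finset.set0)); last by rewrite !andbF.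
rewrite !andbT count_new_edges//.
have [jA|jA] := boolP (j \in A).
  rewrite (negbTE (dAS _ jA)) addn0; apply/subset_leq_card/fintype.subsetP => i.
  by rewrite !inE /= => iS; apply: contraL iS => /dAS.
case: ifP => // jS; rewrite add0n.
apply: leq_trans (_ : \sum_(u in A) #|[set i | con j i == u]%SET| <= _)%N.
  rewrite big_mkcond [leqRHS]big_mkcond/=; apply: leq_sum => u _.
  by case: (u \in A) => //=; case: ifP.
rewrite sum_card_contacts; apply/subset_leq_card/fintype.subsetP => i.
by rewrite !inE.
Qed.

Hypothesis pos_sphere : forall j, sphere (pos j).
Hypothesis r_ge0 : 0 <= r.

(** An edge touching a vertex near j has its source within 2r of j. Each such source sends at most
    2m edges, and an edge adds at most 2 to the sum of degrees. *)
Lemma weight_le (delta : R) j : 0 <= delta ->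
  (forall (k : 'I_n) i, (k < j)%N -> near k != finset.set0 -> con k i \in near k) ->
  \sum_(w in near j) ((deg (G j) w)%:R + delta) <=
    (4 * m%:R + delta) * #|ball_vertices pos (2 * r) (pos j) j|%:R.
Proof.
move=> d0 ok; rewrite big_split/= -natr_sum sumr_const -[delta *+ _]mulr_natr mulrDl.
set B := ball_vertices pos (2 * r) _ _.
have nB : near j \subset B.
  by apply/fintype.subsetP => v; rewrite !inE => /andP[-> h]/=; by rewrite (le_trans h)// mulr_natl mulr2n lerDl.
rewrite lerD//; last by rewrite ler_wpM2l// ler_nat subset_leq_card.
rewrite -!natrM ler_nat; apply: leq_trans (vol_touch _ _) _.
rewrite count_graph_at (_ : 4 * m * #|B| = 2 * (\sum_(k in B) 2 * m))%N; last first.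
  by rewrite sum_nat_const [(#|_| * _)%N]mulnC !mulnA.
rewrite leq_mul2l/= [leqRHS]big_mkcond/= big_mkcond/=; apply: leq_sum => k _.
case: ifP => // kj; case/andP: (size_new_edges k) => _ h.
have [kB|kB] := boolP (k \in B); first exact: leq_trans (count_size _ _) h.
have kn : k \notin near j by apply: contra kB => /(fintype.subsetP nB).
have [k0|k0] := eqVneq (near k) finset.set0; first by rewrite count_loops//= (negbTE kn).
rewrite count_new_edges//= (negbTE kn)/= leqn0 cards_eq0; apply/eqP/setP => i; rewrite finset.in_set0 inE.
apply: contraNF kB; have := ok _ i kj k0; rewrite !inE => /andP[ck h1] /andP[cj h2].
rewrite kj/=; apply: le_trans (angle_triangle (pos_sphere k) (pos_sphere (con k i)) (pos_sphere j)) _.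
by rewrite angleC in h1; lra.
Qed.

(* Every vertex has weight at least [m + delta], and the weights of the vertices
   near [j] add up to at most [(4 m + delta) N]. *)
Lemma contact_prob_lower (delta N : R) j v : (0 < m)%N -> 0 <= delta ->
  (forall (k : 'I_n) i, (k < j)%N -> near k != finset.set0 -> con k i \in near k) ->
  #|ball_vertices pos (2 * r) (pos j) j|%:R <= N -> v \in near j ->
  (4 * N)^-1 <= contact_prob r delta pos con j v.
Proof.
move=> m0 d0 ok BN vn; rewrite /contact_prob vn.
have W := weight_le d0 ok.
have mR : 0 < m%:R :> R by rewrite ltr0n.
have dv : m%:R <= (deg (G j) v)%:R :> R.
  by rewrite ler_nat deg_graph_at//; move: vn; rewrite inE => /andP[].
set w := \sum_(u in near j) _ in W *.
have w0 : 0 < w.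
  rewrite /w (bigD1 v)//= ltr_wpDr//; first by rewrite sumr_ge0// => *; rewrite addr_ge0.
  by rewrite ltr_wpDr//; exact: lt_le_trans dv.
have wN : w <= (4 * m%:R + delta) * N.
  by apply: le_trans W _; rewrite ler_wpM2l// addr_ge0// mulr_ge0.
have md : 0 < 4 * m%:R + delta by rewrite ltr_wpDr// mulr_gt0.
have N0 : 0 < N by rewrite -(pmulr_rgt0 _ md) (lt_le_trans w0).
rewrite ler_pdivlMr// ler_pdivrMl; last by lra.
by nra.
Qed.

(** The endpoints of a crossing edge lie on different sides of the circle and at most r apart, so
    its source is within r of the circle. Loops never cross, and any other source sends m edges. *)
Lemma cut_le_annulus v a :
  (forall k i, near k != finset.set0 -> con k i \in near k) ->
  (Defs.cut (G n) (ball_vertices pos a (pos v) n) <=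
    m * #|[set j | (`|angle (pos j) (pos v) - a| <= r)%R]%SET|)%N.
Proof.
move=> ok; rewrite /Defs.cut count_graph_at mulnC -sum_nat_const.
rewrite [leqRHS]big_mkcond/= big_mkcond/=; apply: leq_sum => k _; rewrite ltn_ord.
have [k0|k0] := eqVneq (near k) finset.set0; first by rewrite count_loops//= addbb.
rewrite count_new_edges//; case: ifP => [_|/negbT kA].
  by apply: leq_trans (max_card _) _; rewrite card_ord.
rewrite leqn0 cards_eq0; apply/eqP/setP => i; rewrite finset.in_set0 inE /=.
apply: contraNF kA; have := ok _ i k0; rewrite !inE !ltn_ord/= => /andP[_ h1].
have t1 := angle_triangle (pos_sphere k) (pos_sphere (con k i)) (pos_sphere v).
have t2 := angle_triangle (pos_sphere (con k i)) (pos_sphere k) (pos_sphere v).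
rewrite [angle (pos k) (pos (con k i))]angleC in t1; rewrite ler_norml.
by have [?|?] := leP (angle (pos k) (pos v)) a;
  have [?|?] := leP (angle (pos (con k i)) (pos v)) a => //= _; lra.
Qed.

End GraphAt.

(** * Exceptional events *)

Section BadEvents.
Context {R : realType} {n m : nat} {r delta : R} (M : base_model n m r delta).
Hypothesis delta_gt0 : 0 < delta.
Notation T := (bm_space M).
Notation pos := (@bm_pos _ _ _ _ _ M).
Notation con := (@bm_con _ _ _ _ _ M).
Notation P := (prob (bm_prob M)).
Notation grid := (@grid_point R n).

Definition hits (J : {set 'I_n}) v a w : {set 'I_n} := [set i in J | pos i w \in cap v a].

Lemma grid_few (j0 : 'I_n) (J : {set 'I_n}) a : 0 <= a <= 1 ->
  let b := (a / 400) ^+ 2 * #|J|%:R / 4 in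
  let E := [set w | exists kl, #|hits J (grid kl) a w|%:R <= b] in
  measurable E /\ P E <= n%:R ^+ 2 * expR (- b).
Proof.
move=> a01 b E.
have h kl := few_hits M (measurable_cap (grid kl) a) J j0 (sqr_ge0 (a / 400))
  (area_cap_ge (sphere_sphere_point _) a01).
split; first by apply: measurable_exists => kl; case: (h kl).
rewrite (_ : n%:R ^+ 2 = #|{: 'I_n * 'I_n}|%:R); last by rewrite card_prod card_ord natrM.
by apply: prob_exists_le => kl; case: (h kl).
Qed.

Lemma grid_many (j0 : 'I_n) (J : {set 'I_n}) a : 0 <= a <= pi ->
  let b := 100 * a ^+ 2 in
  let E := [set w | exists kl, 4 * b * #|J|%:R <= #|hits J (grid kl) a w|%:R] in
  measurable E /\ P E <= n%:R ^+ 2 * expR (- (b * #|J|%:R)).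
Proof.
move=> a01 b E.
have h kl := many_hits M (measurable_cap (grid kl) a) J j0
  (area_cap_le (sphere_sphere_point _) a01).
split; first by apply: measurable_exists => kl; case: (h kl).
rewrite (_ : n%:R ^+ 2 = #|{: 'I_n * 'I_n}|%:R); last by rewrite card_prod card_ord natrM.
by apply: prob_exists_le => kl; case: (h kl).
Qed.

Definition cap_vertices v a (t : nat) w : {set 'I_n} :=
  [set i : 'I_n | (i < t)%N && (pos i w \in cap v a)].

Lemma after_mem_cap (j i : 'I_n) v a : (i <= j)%N ->
  after j [set w | pos i w \in cap v a].
Proof.
move=> ij; rewrite (_ : [set _ | _] = pos i @^-1` cap v a).
  by apply: history_pos => //; exact: measurable_cap.
by apply/seteqP; split => w /=; rewrite inE.
Qed.

Lemma after_cap_vertices (j : 'I_n) v a S :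
  after j (cap_vertices v a j @^-1` [set S]).
Proof.
rewrite /after historyE; apply: measurable_finset => i.
have [ij|ij] := ltnP i j => /=; last exact: (measurable_setbool _ false).
exact: after_mem_cap (ltnW ij).
Qed.

Lemma after_bool (j : 'I_n) (p : T -> bool) b :
  after j [set w | p w] -> after j (p @^-1` [set b]).
Proof.
move=> ap; case: b; first exact: ap.
rewrite (_ : _ @^-1` _ = ~` [set w | p w]); first exact: afterC.
by apply/seteqP; split => w /=; [move=> ->|move/negP/negbTE].
Qed.

(* The choice l = 1 of the parameter in [contacts_tail]. *)
Lemma exp_half_moment (q : R) : 0 <= q <= 1 ->
  expR (q * m%:R / 2) * (1 - (1 - expR (-1)) * q) ^+ m <= 1.
Proof.
move=> q01; have e1 := @expRN1_le R; have e0 := @expR_gt0 R (-1).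
rewrite (_ : q * m%:R / 2 = m%:R * (q / 2)); last by lra.
rewrite expRM_natl -exprMn; apply: exprn_ile1.
  by rewrite mulr_ge0 ?expR_ge0//; nra.
rewrite -ler_pdivlMl ?expR_gt0// mulr1 -expRN.
by apply: le_trans (expR_ge1Dx _); nra.
Qed.

(** A guard for [contacts_tail], as is [reaches_vertex] below. *)
Definition reaches_cap q v a (j : 'I_n) w :=
  (nearby j w != finset.set0) && (q <= \sum_(u in cap_vertices v a j w) cprob j w u).

(** When the guard holds, the event says that at most a quarter of q m contacts fall into the cap.
    The m contacts of one vertex already concentrate, hence the singleton index set. *)
Lemma reaches_cap_tail q v a (j : 'I_n) : 0 <= q <= 1 ->
  let b := q * m%:R / 4 in
  let E := [set w | b <= \sum_(i in [set j]%SET | reaches_cap q v a i w)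
     (q * m%:R / 2 - 1 * (contacts_in i (cap_vertices v a i) w)%:R)] in
  measurable E /\ P E <= expR (- b).
Proof.
move=> q01 b; apply: (contacts_tail delta_gt0 _ _ (q := q)) => //.
- exact: exp_half_moment.
- by move=> i S; exact: after_cap_vertices.
- move=> i; apply: (@after_event _ _ _ _ _ M _ (cap_vertices v a i)).
    by move=> S; exact: after_cap_vertices.
  move=> w w' /past_eq[e1 e2] e3 /=; rewrite /reaches_cap e1 e3.
  by rewrite (eq_bigr (cprob i w')).
- by move=> i w /andP[].
Qed.

Definition reaches_vertex q v a (u j : 'I_n) w :=
  [&& nearby j w != finset.set0, pos j w \in cap v a & q <= cprob j w u].

(** A fixed u is hit by any one vertex too rarely; only the total over all j in J concentrates. *)
Lemma reaches_vertex_tail q v a (u : 'I_n) (J : {set 'I_n}) t : 0 <= q <= 1 ->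
  let E := [set w | t <= \sum_(j in J | reaches_vertex q v a u j w)
     (q * m%:R / 2 - 1 * (contacts_in j (fun=> [set u]%SET) w)%:R)] in
  measurable E /\ P E <= expR (- t).
Proof.
move=> q01; apply: (contacts_tail delta_gt0 _ _ (q := q)) => //.
- exact: exp_half_moment.
- move=> i S; rewrite (_ : _ @^-1` _ = [set w | [set u]%SET == S]).
    by rewrite /after historyE; exact: (measurable_setbool _ ([set u]%SET == S)).
  by apply/seteqP; split => w /= /eqP.
- move=> i; apply: (@after_event _ _ _ _ _ M _ (fun w => pos i w \in cap v a)).
    by move=> b; apply: after_bool; exact: after_mem_cap.
  by move=> w w' /past_eq[e1 e2] e3 /=; rewrite /reaches_vertex e1 e2 e3.
- move=> i w /and3P[n0 _ qu]; split => //.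
  by rewrite big_set1.
Qed.

(* Almost surely all contacts of a vertex are nearby; bounds tending to 0 with
   [l] are enough here and follow from [contacts_tail] with [q = 1]. *)
Lemma far_contact_tail (j : 'I_n) l : 0 <= l ->
  let E := [set w | l <= \sum_(i in [set j]%SET | nearby i w != finset.set0)
     (l * m%:R - l * (contacts_in i (nearby i) w)%:R)] in
  measurable E /\ P E <= expR (- l).
Proof.
move=> l0.
have aN (i : 'I_n) S : after i (nearby i @^-1` [set S] : set T).
  by apply: history_ball => // k ki; exact: ltnW.
apply: (contacts_tail delta_gt0 _ _ (q := 1)) => //.
- by rewrite mulr1 subKr -expRM_natr -expRD mulNr subrr expR0.
- move=> i; apply: (@after_event _ _ _ _ _ M _ (nearby i)) => //.
  by move=> w w' _ /= ->.
- move=> i w n0; split => //; rewrite /cprob sum_contact_prob_near//.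
Qed.

End BadEvents.

(** * Edge expansion on the good event *)

Section Expansion.
Context {R : realType} {n m : nat} {r delta : R} (M : base_model n m r delta).
Hypothesis delta_gt0 : 0 < delta.
Hypothesis m_gt0 : (0 < m)%N.
Hypothesis r_ge0 : 0 <= r.
Notation T := (bm_space M).
Notation pos := (@bm_pos _ _ _ _ _ M).
Notation con := (@bm_con _ _ _ _ _ M).

(* The vertices numbered from [h] on are the late ones.  Each late vertex of A
   sends at least [b] edges to the cap, and each early vertex of A receives at
   least [b] edges from the late vertices of the cap; these edges are distinct
   and all leave A. *)
Lemma expansion (w : T) (h : nat) (k N s : R) (p : vec3 R) (A : {set 'I_n}) :
  0 < k ->
  let q' := (4 * N)^-1 in let q := k * q' in let b := q * m%:R / 4 in
  k <= #|hits [set i : 'I_n | (i < h)%N]%SET p s w|%:R ->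
  k <= #|hits [set i : 'I_n | (h <= i)%N]%SET p s w|%:R ->
  (forall j : 'I_n, #|ball_vertices (pos^~ w) (2 * r) (pos j w) j|%:R <= N) ->
  (forall j, ~ (b <= \sum_(i in [set j]%SET | reaches_cap q p s i w)
     (q * m%:R / 2 - 1 * (contacts_in i (cap_vertices p s i) w)%:R))) ->
  (forall u, ~ (b <= \sum_(j in [set i : 'I_n | (h <= i)%N]%SET | reaches_vertex q' p s u j w)
     (q' * m%:R / 2 - 1 * (contacts_in j (fun=> [set u]%SET) w)%:R))) ->
  (forall j i, nearby j w != finset.set0 -> con j i w \in nearby j w) ->
  (forall i, i \in A -> pos i w \notin cap p s) ->
  (forall a j, a \in A -> pos j w \in cap p s -> angle (pos j w) (pos a w) <= r) ->
  b * #|A|%:R <= (Defs.cut (final_graph w) A)%:R.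
Proof.
move=> k0 q' q b H1 H2 H3 H4 H5 H6 HA1 HA2.
have cl j v : v \in nearby j w -> q' <= cprob j w v.
  move=> vn; apply: contact_prob_lower => //.
  - by move=> i; exact: sphere_pos.
  - exact: ltW.
  - by move=> i l _; exact: H6.
set E := [set i : 'I_n | (i < h)%N]%SET in H1.
set L := [set i : 'I_n | (h <= i)%N]%SET in H2 H5.
pose S : {set 'I_n} := [set i | pos i w \in cap p s]%SET.
have lateA j : j \in A -> (h <= j)%N ->
    nearby j w != finset.set0 /\ b <= #|[set i | con j i w \in S]%SET|%:R.
  move=> jA hj.
  have Hn i : i \in hits E p s w -> i \in nearby j w.
    rewrite !inE => /andP[ih ic]; rewrite (leq_trans ih hj)/=.
    by apply: HA2 => //; rewrite inE.
  have n0 : nearby j w != finset.set0.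
    have : (0 < #|hits E p s w|)%N by rewrite -(ltr_nat R) (lt_le_trans k0).
    by case/card_gt0P => i /Hn ?; apply/set0Pn; exists i.
  split => //.
  have rc : reaches_cap q p s j w.
    rewrite /reaches_cap n0/=.
    (* At least k early cap vertices are available, each chosen with probability at least q';
       together they give q = k q'. *)
    apply: le_trans (_ : \sum_(u in hits E p s w) q' <= _).
      rewrite sumr_const -mulr_natl /q ler_wpM2r// /q' invr_ge0 mulr_ge0//.
      exact: le_trans (H3 j).
    rewrite big_mkcond [leRHS]big_mkcond/=; apply: ler_sum => u _.
    case: ifP => [uH|_]; last by case: ifP => // _; exact: contact_prob_ge0.
    have -> : u \in cap_vertices p s j w.
      by move: uH; rewrite !inE => /andP[uh ->]; rewrite andbT (leq_trans uh).
    exact/cl/Hn.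
  have := H4 j.
  rewrite (_ : \sum_(i in [set j]%SET | _) _ =
     q * m%:R / 2 - (contacts_in j (cap_vertices p s j) w)%:R); last first.
    rewrite big_mkcondr/= big_set1 rc mul1r//.
  move=> /negP; rewrite -ltNge ltrBlDr => lt.
  apply: le_trans (_ : (contacts_in j (cap_vertices p s j) w)%:R <= _).
    by move: lt; rewrite /b; lra.
  rewrite ler_nat; apply/subset_leq_card/fintype.subsetP => i.
  by rewrite !inE => /andP[_ /set_mem].
have earlyA u : u \in A -> (u < h)%N ->
    b <= (\sum_(j in S | (h <= j)%N && (nearby j w != finset.set0))
     #|[set i | con j i w == u]%SET|)%:R.
  move=> uA uh.
  have Hn j : j \in hits L p s w -> reaches_vertex q' p s u j w.
    rewrite !inE => /andP[hj jc].
    have un : u \in nearby j w.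
      rewrite !inE (leq_trans uh hj)/= angleC.
      by apply: HA2 => //; rewrite inE.
    rewrite /reaches_vertex cl// andbT; apply/andP; split.
      by apply/set0Pn; exists u.
    by [].
  have := H5 u => /negP; rewrite -ltNge sumrB => lt.
  have kL : k * (q' * m%:R / 2) <= \sum_(j in L | reaches_vertex q' p s u j w) (q' * m%:R / 2).
    apply: le_trans (_ : \sum_(j in hits L p s w) (q' * m%:R / 2) <= _).
      rewrite sumr_const -[leRHS]mulr_natl ler_wpM2r// !mulr_ge0// /q' invr_ge0 mulr_ge0//.
      exact: le_trans (H3 u).
    rewrite big_mkcond [leRHS]big_mkcond/=; apply: ler_sum => j _.
    have q0 : 0 <= q' * m%:R / 2.
      by rewrite !mulr_ge0// /q' invr_ge0 mulr_ge0//; exact: le_trans (H3 u).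
    case: ifP => [jH|_]; last by case: ifP.
    by rewrite Hn// andbT; move: jH; rewrite !inE => /andP[->].
  apply: le_trans (_ : \sum_(j in L | reaches_vertex q' p s u j w)
      1 * (contacts_in j (fun=> [set u]%SET) w)%:R <= _).
    by move: lt kL; rewrite /b /q; lra.
  rewrite natr_sum big_mkcond [leRHS]big_mkcond/=; apply: ler_sum => j _.
  case: ifP => [/andP[]|_]; last by case: ifP.
  rewrite inE => hj /and3P[n0 jc _]; rewrite inE jc hj n0 mul1r ler_nat.
  by apply/subset_leq_card/fintype.subsetP => i; rewrite !inE.
have dAS j : j \in A -> j \notin S by move=> jA; rewrite inE; exact: HA1.
have := cut_ge r (pos^~ w) (fun k l => con k l w) h dAS; rewrite -(ler_nat R) natrD.
apply: le_trans; rewrite !natr_sum -sum1_card natr_sum mulr_sumr mulr1.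
rewrite (bigID (fun j : 'I_n => (h <= j)%N))/=; apply: lerD.
  rewrite big_mkcond [leRHS]big_mkcond/=; apply: ler_sum => j _.
  case: ifP => [/andP[jA hj]|hj].
    have [n0 bj] := lateA _ jA hj; rewrite jA hj.
    by rewrite ifT.
  by case: ifP.
rewrite (eq_bigl (fun u : 'I_n => (u \in A) && (u < h)%N)); last by move=> u; rewrite -ltnNge.
by apply: ler_sum => u /andP[uA uh]; exact: earlyA.
Qed.
End Expansion.

(* The constant is k / (4 N) in [expansion_event] for the values of k and N
   chosen in [expansion_small] and [expansion_large]. *)
Definition rate (R : realType) : R := ((100 * 400) ^+ 2 * 16 * (4 * 60 ^+ 2))^-1.

Lemma rate_gt0 (R : realType) : 0 < rate R.
Proof. by rewrite invr_gt0; lra. Qed.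

Lemma rate_le1 (R : realType) : rate R <= 1.
Proof. by rewrite invf_le1; lra. Qed.

Section Events.
Context {R : realType} {n m : nat} {r delta : R} (M : base_model n m r delta).
Hypothesis delta_gt0 : 0 < delta.
Hypothesis n_gt1 : (1 < n)%N.
Hypothesis m_gt0 : (0 < m)%N.
Notation T := (bm_space M).
Notation pos := (@bm_pos _ _ _ _ _ M).
Notation con := (@bm_con _ _ _ _ _ M).
Notation P := (prob (bm_prob M)).
Notation grid := (@grid_point R n).

Let j0 : 'I_n := Ordinal (ltnW n_gt1).
Let h := n./2.
Let early := [set i : 'I_n | (i < h)%N]%SET.
Let late := [set i : 'I_n | (h <= i)%N]%SET.

Lemma edges_event : exists Bad : set T, [/\ measurable Bad,
  P Bad <= n%:R * expR (- n%:R) &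
  forall w, ~ Bad w -> forall j i, nearby j w != finset.set0 -> con j i w \in nearby j w].
Proof.
have b j := far_contact_tail M delta_gt0 j (ler0n R n).
exists [set w | exists j, [set w | n%:R <= (\sum_(i in [set j]%SET | nearby i w != finset.set0)
     (n%:R * m%:R - n%:R * (contacts_in i (nearby i) w)%:R) : R)] w].
split.
- by apply: measurable_exists => j; case: (b j).
- rewrite -[X in _ <= X%:R * _](card_ord n); apply: prob_exists_le => j; case: (b j) => //.
- move=> w nB j i nj.
  have : ~ (n%:R <= (\sum_(i in [set j]%SET | nearby i w != finset.set0)
     (n%:R * m%:R - n%:R * (contacts_in i (nearby i) w)%:R) : R)).
    by move=> Bj; apply: nB; exists j.
  rewrite big_mkcondr/= big_set1 nj => /negP; rewrite -ltNge -mulrBr => lt.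
  have nR : 0 < n%:R :> R by rewrite ltr0n ltnW.
  (* With l = n the bad event is that at least one contact is missing from the neighbourhood, so
     outside it none is. *)
  have lt1 : m%:R - (contacts_in j (nearby j) w)%:R < 1 :> R.
    by rewrite -(ltr_pM2l nR) mulr1.
  have mc : (m <= contacts_in j (nearby j) w)%N.
    by rewrite -ltnS -(ltr_nat R) -natr1; lra.
  have /eqP E : [set i | con j i w \in nearby j w]%SET == [set: 'I_m]%SET.
    by rewrite eqEcard finset.subsetT/= cardsT card_ord.
  have : i \in [set: 'I_m]%SET by rewrite finset.in_setT.
  by rewrite -E inE.
Qed.

Lemma card_early : n%:R / 4 <= #|early|%:R :> R.
Proof.
have hn : (h <= n)%N by rewrite /h -divn2 leq_div.
have -> : #|early| = h.
  rewrite -sum1_card (eq_bigl (fun i : 'I_n => i < h)%N) => [|i]; last by rewrite inE.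
  by rewrite (big_ord_narrow hn) sum1_card card_ord.
have : (n <= 4 * h)%N by rewrite /h -divn2; move: n_gt1; lia.
by rewrite -(ler_nat R) natrM => ?; rewrite ler_pdivrMr// mulrC.
Qed.

Lemma card_late : n%:R / 4 <= #|late|%:R :> R.
Proof.
have -> : late = (~: early)%SET by apply/setP => i; rewrite !inE -leqNgt.
have := cardsC early; rewrite card_ord.
have hn : (#|early| <= h)%N.
  have hn : (h <= n)%N by rewrite /h -divn2 leq_div.
  rewrite -sum1_card (eq_bigl (fun i : 'I_n => i < h)%N) => [|i]; last by rewrite inE.
  by rewrite (big_ord_narrow hn) sum1_card card_ord.
move=> e; have : (n <= 4 * #|(~: early)%SET|)%N.
  by move: hn n_gt1 e; rewrite /h -divn2; move: #|_| #|_| => x y; lia.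
by rewrite -(ler_nat R) natrM => ?; rewrite ler_pdivrMr// mulrC.
Qed.

(** The bad set collects long edges, caps short of early or of late vertices, and the failures of
    the two contact bounds over grid points and vertices. The density bound N remains a hypothesis,
    since it is obtained differently in the two regimes of r. The 16 is 4 from [few_hits] times 4
    from the halves having at least n / 4 vertices. *)
Lemma expansion_event (s k N q q' : R) : 0 <= r -> 0 <= s <= 1 -> 0 < k ->
  q' = (4 * N)^-1 -> q = k * q' -> 0 <= q' <= 1 -> 0 <= q <= 1 ->
  k <= (s / 400) ^+ 2 * n%:R / 16 ->
  let b := q * m%:R / 4 in
  exists Bad : set T, [/\ measurable Bad,
    P Bad <= n%:R * expR (- n%:R) + 2 * (n%:R ^+ 2 * expR (- k)) +
       2 * (n%:R ^+ 3 * expR (- b)) &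
    forall w, ~ Bad w ->
     (forall j : 'I_n, #|ball_vertices (pos^~ w) (2 * r) (pos j w) j|%:R <= N) ->
     forall (kl : 'I_n * 'I_n) (A : {set 'I_n}),
     (forall i, i \in A -> pos i w \notin cap (grid kl) s) ->
     (forall a j, a \in A -> pos j w \in cap (grid kl) s -> angle (pos j w) (pos a w) <= r) ->
     b * #|A|%:R <= (Defs.cut (final_graph w) A)%:R].
Proof.
move=> r0 s01 k0 q'E qE q'01 q01 kn b.
have [B0 [mB0 PB0 goodB0]] := edges_event.
have kJ (J : {set 'I_n}) : n%:R / 4 <= #|J|%:R :> R -> k <= (s / 400) ^+ 2 * #|J|%:R / 4.
  by have := sqr_ge0 (s / 400); nra.
have [mB1 PB1] := grid_few M j0 early s01; set B1 := [set w | _] in mB1 PB1.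
have [mB2 PB2] := grid_few M j0 late s01; set B2 := [set w | _] in mB2 PB2.
have b3 (z : ('I_n * 'I_n) * 'I_n) := reaches_cap_tail M delta_gt0 (grid z.1) s z.2 q01.
pose B3 : set T := [set w | exists z : ('I_n * 'I_n) * 'I_n,
  [set w | b <= \sum_(i in [set z.2]%SET | reaches_cap q (grid z.1) s i w)
     (q * m%:R / 2 - 1 * (contacts_in i (cap_vertices (grid z.1) s i) w)%:R)] w].
have b4 (z : ('I_n * 'I_n) * 'I_n) := reaches_vertex_tail M delta_gt0 (grid z.1) s z.2 late b q'01.
pose B4 : set T := [set w | exists z : ('I_n * 'I_n) * 'I_n,
  [set w | b <= \sum_(j in late | reaches_vertex q' (grid z.1) s z.2 j w)
     (q' * m%:R / 2 - 1 * (contacts_in j (fun=> [set z.2]%SET) w)%:R)] w].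
have n3 : n%:R ^+ 3 = #|{: ('I_n * 'I_n) * 'I_n}|%:R :> R.
  by rewrite !card_prod !card_ord !natrM exprSr.
have mB3 : measurable B3 by apply: measurable_exists => z; case: (b3 z).
have mB4 : measurable B4 by apply: measurable_exists => z; case: (b4 z).
have PB3 : P B3 <= n%:R ^+ 3 * expR (- b).
  by rewrite n3; apply: prob_exists_le => z; case: (b3 z).
have PB4 : P B4 <= n%:R ^+ 3 * expR (- b).
  by rewrite n3; apply: prob_exists_le => z; case: (b4 z).
have n2 : 0 <= n%:R ^+ 2 :> R by exact: exprn_ge0.
have PB1' : P B1 <= n%:R ^+ 2 * expR (- k).
  apply: le_trans PB1 _; rewrite ler_wpM2l// ler_expR lerN2; exact/kJ/card_early.
have PB2' : P B2 <= n%:R ^+ 2 * expR (- k).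
  apply: le_trans PB2 _; rewrite ler_wpM2l// ler_expR lerN2; exact/kJ/card_late.
exists (B0 `|` (B1 `|` (B2 `|` (B3 `|` B4)))); split.
- by do 4 apply: measurableU => //.
- apply: le_trans (prob_setU_le _ _ _) _ => //; first by do 3 apply: measurableU => //.
  rewrite -!addrA lerD//; apply: le_trans (prob_setU_le _ _ _) _ => //.
    by do 2 apply: measurableU => //.
  have U2 := prob_setU_le (bm_prob M) mB2 (measurableU _ _ mB3 mB4).
  have U3 := prob_setU_le (bm_prob M) mB3 mB4.
  by lra.
- move=> w nB H3 kl A HA1 HA2.
  have [nB0 nB1 nB2 nB3 nB4] : [/\ ~ B0 w, ~ B1 w, ~ B2 w, ~ B3 w & ~ B4 w].
    by split => Bw; apply: nB; [left|right;left|right;right;left|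
      right;right;right;left|right;right;right;right].
  rewrite /b qE q'E; apply: (expansion delta_gt0 m_gt0 r0 (h := h) (s := s) (p := grid kl)) => //.
  - apply: le_trans (kJ _ card_early) _; rewrite leNgt; apply/negP => lt.
    by apply: nB1; exists kl; exact: ltW.
  - apply: le_trans (kJ _ card_late) _; rewrite leNgt; apply/negP => lt.
    by apply: nB2; exists kl; exact: ltW.
  - by rewrite -q'E -qE => j Bj; apply: nB3; exists (kl, j).
  - by rewrite -q'E -qE => j Bj; apply: nB4; exists (kl, j).
  - exact: goodB0.
Qed.

(** On the side B with the expansion, vol B <= 4 m |B| + cut <= (16 / q + 1) cut, and the smaller
    volume is at most vol B. Both sides being nonempty keeps the denominator positive. *)
Lemma conductance_lower (w : T) (q : R) (A : {set 'I_n}) : 0 < q ->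
  A != finset.set0 -> A != [set: 'I_n]%SET ->
  (q * m%:R / 4 * #|A|%:R <= (Defs.cut (final_graph w) A)%:R \/
   q * m%:R / 4 * #|(~: A)%SET|%:R <= (Defs.cut (final_graph w) A)%:R) ->
  (1 + 16 / q)^-1 <= conductance R (final_graph w) A.
Proof.
move=> q0 A0 AT hA; rewrite /conductance.
set G := final_graph w in hA *; set c := Defs.cut G A in hA *.
have vpos (B : {set 'I_n}) : B != finset.set0 -> (0 < vol G B)%N.
  move=> B0; apply: leq_trans (vol_ge _ _ _ _); by rewrite muln_gt0 m_gt0 card_gt0.
have m0 : (0 < minn (vol G A) (vol G (~: A)))%N.
  rewrite leq_min !vpos//; apply: contra_neq AT => e.
  by rewrite -[A]finset.setCK e finset.setC0.
have c1 : 0 < 1 + 16 / q by rewrite addr_gt0// divr_gt0.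
rewrite ler_pdivlMr ?ltr0n// ler_pdivrMl//.
have key (B : {set 'I_n}) : Defs.cut G B = c -> q * m%:R / 4 * #|B|%:R <= c%:R ->
    (vol G B)%:R <= (1 + 16 / q) * c%:R :> R.
  move=> cB hB; have := vol_le r ((@bm_pos _ _ _ _ _ M)^~ w) (fun k l => con k l w) B.
  rewrite -/(final_graph w) -/G cB -(ler_nat R) natrD !natrM => /le_trans; apply.
  have -> : 4 * m%:R * #|B|%:R = 16 / q * (q * m%:R / 4 * #|B|%:R) :> R.
    by field; rewrite gt_eqF.
  have q16 : 0 <= 16 / q by rewrite divr_ge0// ltW.
  by have := ler_wpM2l q16 hB; rewrite mulrDl mul1r; lra.
case: hA => hA.
  by apply: le_trans (key A erefl hA); rewrite ler_nat geq_minl.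
by apply: le_trans (key _ (cutC _ _) hA); rewrite ler_nat geq_minr.
Qed.

Lemma nbh_self (w : T) (a : R) v : 0 <= a -> v \in neighborhood a v w.
Proof. by move=> a0; rewrite inE ltn_ord/= angle_diag//; exact: sphere_pos. Qed.

Lemma nbhE (w : T) (a : R) v i : (i \in neighborhood a v w) = (angle (pos i w) (pos v w) <= a).
Proof. by rewrite inE ltn_ord. Qed.

Let grid_near v : sphere v -> exists kl, angle v (grid kl) <= 100 / n%:R.
Proof. by apply: grid_point_dense; exact: ltnW. Qed.

Lemma mem_cap_angle (w : T) i p a : sphere p -> 0 <= a <= pi ->
  (pos i w \in cap p a) = (angle (pos i w) p <= a).
Proof. by move=> sp a0; rewrite angle_cap//; exact: sphere_pos. Qed.

(* For every cap A of radius at most r / 100 there is a grid point at distance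
   about r / 2 whose cap of radius r / 100 is disjoint from A but entirely
   within reach r of every point of A. *)
Lemma expansion_small : 0 < r <= 1 -> 1 <= r ^+ 2 * n%:R -> 100 / n%:R <= r / 100 ->
  exists Bad : set T, [/\ measurable Bad,
    P Bad <= n%:R * expR (- n%:R) +
       2 * (n%:R ^+ 2 * expR (- ((r / 100 / 400) ^+ 2 * n%:R / 16))) +
       2 * (n%:R ^+ 3 * expR (- (rate R * m%:R / 4))) +
       n%:R ^+ 2 * expR (- (100 * (3 * r) ^+ 2 * n%:R)) &
    forall w, ~ Bad w -> forall a v, 0 <= a <= r / 100 ->
      neighborhood a v w != [set: 'I_n]%SET ->
      (1 + 16 / rate R)^-1 <= conductance R (final_graph w) (neighborhood a v w)].
Proof.
move=> /andP[r0 r1] rn nr.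
have nR : 0 < n%:R :> R by rewrite ltr0n ltnW.
have p2 := @pi_ge2 R.
set k := (r / 100 / 400) ^+ 2 * n%:R / 16.
(* This is the bound 4 times 100 (3r)^2 n of [grid_many]: a ball of radius 2r lies in a grid cap of
   radius 3r. *)
pose N := (60 * r) ^+ 2 * n%:R.
have k0 : 0 < k by rewrite /k; lra.
have N1 : 1 <= N.
  by rewrite /N exprMn -mulrA; lra.
have q'01 : 0 <= (4 * N)^-1 <= 1.
  by rewrite invr_ge0 invf_le1; lra.
have qE : rate R = k * (4 * N)^-1.
  by rewrite /rate /k /N; field; rewrite !gt_eqF.
have q01 : 0 <= rate R <= 1 by rewrite rate_le1 ltW// rate_gt0.
have s01 : 0 <= r / 100 <= 1 by lra.
have [B1 [mB1 PB1 H1]] := expansion_event (ltW r0) s01 k0 erefl qE q'01 q01 (lexx _).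
have [B2 [mB2 PB2 H2]] : exists Bad : set T, [/\ measurable Bad,
    P Bad <= n%:R ^+ 2 * expR (- (100 * (3 * r) ^+ 2 * n%:R)) &
    forall w, ~ Bad w -> forall j : 'I_n,
      #|ball_vertices (pos^~ w) (2 * r) (pos j w) j|%:R <= N].
  (* For r >= 1/2 the number N exceeds n; below 1/2 the radius 3r stays under 2 <= pi, as
     [grid_many] demands. *)
  have [r2|r2] := leP (1 / 2) r.
    exists set0; split; [exact: measurable0| |].
      by rewrite prob_set0 mulr_ge0 ?expR_ge0 ?exprn_ge0.
    move=> w _ j; apply: (@le_trans _ _ n%:R).
      by rewrite ler_nat -[leqRHS]card_ord; exact: max_card.
    by rewrite /N ler_peMl//; nra.
  have a0 : 0 <= 3 * r <= pi by lra.
  have [mB PB] := grid_many M j0 [set: 'I_n]%SET a0; rewrite cardsT card_ord in mB PB.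
  eexists; split; [exact: mB|exact: PB|] => w nB j.
  have [kl jkl] := grid_near (sphere_pos j w).
  rewrite leNgt; apply/negP => lt; apply: nB; exists kl.
  apply: le_trans (_ : #|ball_vertices (pos^~ w) (2 * r) (pos j w) j|%:R <= _).
    by move: lt; rewrite /N => /ltW; lra.
  rewrite ler_nat; apply/subset_leq_card/fintype.subsetP => i; rewrite inE => /andP[_ ij].
  rewrite inE finset.in_setT/= mem_cap_angle//; last exact: sphere_sphere_point.
  apply: le_trans (angle_triangle (sphere_pos i w) (sphere_pos j w) (sphere_sphere_point _)) _.
  by lra.
exists (B1 `|` B2); split; first exact: measurableU.
  by apply: le_trans (prob_setU_le _ _ _) _ => //; rewrite lerD.
move=> w nB a v a0 AT.
have nB1 : ~ B1 w by move=> Bw; apply: nB; left.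
have nB2 : ~ B2 w by move=> Bw; apply: nB; right.
apply: conductance_lower => //; first exact: rate_gt0.
  by apply/set0Pn; exists v; apply: nbh_self; lra.
left.
(* The mesh, the cap and the ball A each cost at most r / 100, so distances from A to the cap stay
   within 3r / 100 of r / 2. *)
have [q sq vq] := exists_at_angle (sphere_pos v w) (ltac:(lra) : 0 <= r / 2 <= pi).
have [kl qkl] := grid_near sq.
have sg : sphere (grid kl) by exact: sphere_sphere_point.
have capE i : (pos i w \in cap (grid kl) (r / 100)) = (angle (pos i w) (grid kl) <= r / 100).
  by rewrite mem_cap_angle//; lra.
have t1 := angle_triangle (sphere_pos v w) sg sq.
have t2 := angle_triangle (sphere_pos v w) sq sg.
rewrite [angle (grid kl) q]angleC in t1.
apply: (H1 _ nB1 (H2 _ nB2) kl).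
- move=> i; rewrite nbhE capE -ltNge => iv.
  have := angle_triangle (sphere_pos v w) (sphere_pos i w) sg.
  by rewrite [angle (pos v w) (pos i w)]angleC; lra.
- move=> i j; rewrite nbhE capE => iv jg.
  have t3 := angle_triangle (sphere_pos j w) sg (sphere_pos i w).
  have := angle_triangle sg (sphere_pos v w) (sphere_pos i w).
  rewrite [angle (pos v w) (pos i w)]angleC [angle (grid kl) (pos v w)]angleC => t4.
  by lra.
Qed.

(* Here r exceeds the diameter of the sphere, and one of A and its complement
   is disjoint from a fixed cap. *)
Lemma expansion_large : 4 <= r -> 100 / n%:R <= 1 / 100 :> R ->
  exists Bad : set T, [/\ measurable Bad,
    P Bad <= n%:R * expR (- n%:R) +
       2 * (n%:R ^+ 2 * expR (- ((1 / 100 / 400) ^+ 2 * n%:R / 16))) +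
       2 * (n%:R ^+ 3 * expR (- (rate R * m%:R / 4))) &
    forall w, ~ Bad w -> forall a v, 0 <= a ->
      neighborhood a v w != [set: 'I_n]%SET ->
      (1 + 16 / rate R)^-1 <= conductance R (final_graph w) (neighborhood a v w)].
Proof.
move=> r4 nr.
have nR : 0 < n%:R :> R by rewrite ltr0n ltnW.
have p2 := @pi_ge2 R; have p4 := @pi_lt4 R.
set k := (1 / 100 / 400) ^+ 2 * n%:R / 16.
(* Any N >= n bounds the density; this one makes k / (4N) equal to the same [rate]. *)
pose N := (60 * 1) ^+ 2 * n%:R : R.
have k0 : 0 < k by rewrite /k; lra.
have n1 : 1 <= n%:R :> R by rewrite ler1n ltnW.
have N1 : 1 <= N by rewrite /N; lra.
have q'01 : 0 <= (4 * N)^-1 <= 1 by rewrite invr_ge0 invf_le1; lra.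
have qE : rate R = k * (4 * N)^-1.
  by rewrite /rate /k /N; field; rewrite !gt_eqF.
have q01 : 0 <= rate R <= 1 by rewrite rate_le1 ltW// rate_gt0.
have s01 : 0 <= (1 / 100 : R) <= 1 by lra.
have r0 : 0 <= r by lra.
have [B1 [mB1 PB1 H1]] := expansion_event r0 s01 k0 erefl qE q'01 q01 (lexx _).
have H2 w (j : 'I_n) : #|ball_vertices (pos^~ w) (2 * r) (pos j w) j|%:R <= N.
  apply: (@le_trans _ _ n%:R).
    by rewrite ler_nat -[leqRHS]card_ord; exact: max_card.
  by rewrite /N; lra.
exists B1; split => // w nB a v a0 AT.
apply: conductance_lower => //; first exact: rate_gt0.
  by apply/set0Pn; exists v; exact: nbh_self.
have capE i kl : (pos i w \in cap (grid kl) (1 / 100)) = (angle (pos i w) (grid kl) <= 1 / 100).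
  by rewrite mem_cap_angle//; [exact: sphere_sphere_point|lra].
have far i j : angle (pos j w) (pos i w) <= r.
  by have := angle_lepi (sphere_pos j w) (sphere_pos i w); lra.
(* A ball of radius at most pi / 2 avoids a cap near the antipode of v; a larger one contains a cap
   near v, which its complement then avoids. *)
have [ap|pa] := leP a (pi / 2); [left|right].
  have [q sq vq] := exists_at_angle (sphere_pos v w) (ltac:(lra) : 0 <= pi <= pi).
  have [kl qkl] := grid_near sq.
  have sg : sphere (grid kl) by exact: sphere_sphere_point.
  apply: (H1 _ nB (H2 _) kl) => // i; rewrite nbhE capE -ltNge => iv.
  have t1 := angle_triangle (sphere_pos v w) sg sq.
  have := angle_triangle (sphere_pos v w) (sphere_pos i w) sg.
  rewrite [angle (grid kl) q]angleC in t1.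
  by rewrite [angle (pos v w) (pos i w)]angleC; lra.
rewrite -cutC.
have [kl qkl] := grid_near (sphere_pos v w).
have sg : sphere (grid kl) by exact: sphere_sphere_point.
apply: (H1 _ nB (H2 _) kl) => // i; rewrite finset.in_setC nbhE capE -!ltNge => iv.
have := angle_triangle (sphere_pos i w) sg (sphere_pos v w).
by rewrite [angle (grid kl) (pos v w)]angleC; lra.
Qed.

End Events.

(** * Large balls *)

Lemma card_cover_le (R : realType) (I J : finType) (B : {set I}) (H : J -> {set I}) (c : R) :
  (forall i, i \in B -> exists k, i \in H k) -> (forall k, #|H k|%:R <= c) ->
  #|B|%:R <= #|J|%:R * c.
Proof.
move=> BH Hc; apply: (@le_trans _ _ (\sum_k #|H k|)%:R).
  rewrite ler_nat -sum1_card (eq_bigr (fun k => \sum_(i in H k) 1)%N); last first.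
    by move=> k _; rewrite sum1_card.
  rewrite (exchange_big_dep predT)//= big_mkcond/=; apply: leq_sum => i _.
  case: ifP => // iB; have [k ik] := BH _ iB.
  by rewrite (bigD1 k)//= leq_addr.
rewrite natr_sum; apply: le_trans (_ : \sum_(k : J) c <= _); first exact: ler_sum.
by rewrite sumr_const mulr_natl.
Qed.

(** The cut is at most m times 2 (a / r) caps times 400 (26 r)^2 n vertices, and both volumes are at
    least m (a / 1600)^2 n / 4; the quotient is this constant times r / a. *)
Definition sparsity (R : realType) : R := 2 * (400 * 26 ^+ 2) * (1600 ^+ 2 * 4).

(** The deterministic half of the argument: only short edges and the occupancy of grid caps of four
    radii enter. *)
Lemma large_ball_bounds (R : realType) (n m : nat) (r delta a : R)
    (M : base_model n m r delta) (w : bm_space M) v :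
  (1 < n)%N -> (0 < m)%N -> 0 < r -> 26 * r <= 1 -> r <= a <= 1 ->
  100 / n%:R <= r / 2 ->
  (forall j i, nearby j w != finset.set0 -> bm_con j i w \in nearby j w) ->
  (forall kl : 'I_n * 'I_n, (a / 2 / 400) ^+ 2 * n%:R / 4 <= #|hits [set: 'I_n]%SET (grid_point kl) (a / 2) w|%:R) ->
  (forall kl : 'I_n * 'I_n, (1 / 4 / 400) ^+ 2 * n%:R / 4 <= #|hits [set: 'I_n]%SET (grid_point kl) (1 / 4) w|%:R :> R) ->
  (forall kl : 'I_n * 'I_n, #|hits [set: 'I_n]%SET (grid_point kl) (2 * a) w|%:R <= 4 * (100 * (2 * a) ^+ 2) * n%:R) ->
  (forall kl : 'I_n * 'I_n, #|hits [set: 'I_n]%SET (grid_point kl) (26 * r) w|%:R <= 4 * (100 * (26 * r) ^+ 2) * n%:R) ->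
  let A := neighborhood a v w in
  [/\ (a / 800) ^+ 2 * n%:R / 4 <= #|A|%:R,
      #|A|%:R <= 1600 * a ^+ 2 * n%:R &
      conductance R (final_graph w) A <= sparsity R * (r / a)].
Proof.
move=> n_gt1 m_gt0 r0 r1 /andP[ra a1] nr H0 H1 H2 H3 H4 A.
have nR : 0 < n%:R :> R by rewrite ltr0n ltnW.
have grid_near (u : vec3 R) : sphere u -> exists kl : 'I_n * 'I_n, angle u (grid_point kl) <= 100 / n%:R.
  by apply: grid_point_dense; exact: ltnW.
have sg (kl : 'I_n * 'I_n) : sphere (@grid_point R n kl) by exact: sphere_sphere_point.
have hitE i (kl : 'I_n * 'I_n) (b : R) : 0 <= b <= pi ->
    (i \in hits [set: 'I_n]%SET (grid_point kl) b w) = (angle (bm_pos i w) (grid_point kl) <= b).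
  by move=> b0; rewrite inE finset.in_setT/= mem_cap_angle.
have [b1 b2 b3 [b4 b5]] : [/\ 0 <= a / 2 <= pi, 0 <= (1 / 4 : R) <= pi, 0 <= 2 * a <= pi &
    0 <= 26 * r <= pi /\ 0 <= a <= pi].
  by have p2 := @pi_ge2 R; clear - p2 r0 r1 ra a1; split; [| | |split]; lra.
have [kl vkl] := grid_near _ (sphere_pos v w).
have A1 : (a / 800) ^+ 2 * n%:R / 4 <= #|A|%:R.
  rewrite (_ : a / 800 = a / 2 / 400); last by lra.
  apply: le_trans (H1 kl) _; rewrite ler_nat; apply/subset_leq_card/fintype.subsetP => i.
  rewrite hitE// nbhE.
  have := angle_triangle (sphere_pos i w) (sg kl) (sphere_pos v w).
  rewrite [angle (grid_point kl) _]angleC; clear - vkl nr ra; lra.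
have A2 : #|A|%:R <= 1600 * a ^+ 2 * n%:R.
  rewrite (_ : 1600 * a ^+ 2 = 4 * (100 * (2 * a) ^+ 2)); last by ring.
  apply: le_trans (H3 kl); rewrite ler_nat; apply/subset_leq_card/fintype.subsetP => i.
  rewrite hitE// nbhE.
  have := angle_triangle (sphere_pos i w) (sphere_pos v w) (sg kl).
  clear - vkl nr r0 ra; lra.
have A3 : (1 / 1600) ^+ 2 * n%:R / 4 <= #|(~: A)%SET|%:R :> R.
  (* Since a <= 1 and pi >= 2, a cap of radius 1/4 near the antipode of v misses A. *)
  have [q sq' vq] := exists_at_angle (sphere_pos v w) (ltac:(by rewrite pi_ge0 lexx) : 0 <= pi <= pi).
  have [kl' qkl'] := grid_near _ sq'.
  rewrite (_ : 1 / 1600 = 1 / 4 / 400); last by lra.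
  apply: le_trans (H2 kl') _; rewrite ler_nat; apply/subset_leq_card/fintype.subsetP => i.
  rewrite hitE// finset.in_setC nbhE -ltNge.
  have t1 := angle_triangle (sphere_pos v w) (sg kl') sq'.
  rewrite [angle (grid_point kl') q]angleC vq in t1.
  have := angle_triangle (sphere_pos v w) (sphere_pos i w) (sg kl').
  rewrite [angle (bm_pos v w) (bm_pos i w)]angleC; have p2 := @pi_ge2 R.
  clear - t1 qkl' nr r1 a1 p2; lra.
split => //.
pose N := (Num.truncn (a / r)).+1.
have ar : 1 <= a / r by rewrite ler_pdivlMr// mul1r.
have /andP[N1 N2] := truncn_itv (le_trans ler01 ar).
have NR : N%:R <= 2 * (a / r) by rewrite /N -natr1; clear - N1 ar; lra.
have N0 : 0 < N%:R :> R by rewrite ltr0n.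
(* The radius 26 r has room for r from the annulus, 24 r from the spacing of the centres and r / 2
   from the mesh. *)
have aN : 24 * a / N%:R <= 24 * r.
  rewrite ler_pdivrMr// -mulrA ler_pM2l//.
  by rewrite -ler_pdivrMl// mulrC ltW.
have [qs [sqs cov]] := annulus_cover (ltn0Sn _ : (0 < N)%N) (sphere_pos v w) b5.
have /choice[f hf] : forall k, exists kl : 'I_n * 'I_n, angle (qs k) (grid_point kl) <= 100 / n%:R.
  by move=> k; exact: grid_near.
set B : {set 'I_n} := [set j | `|angle (bm_pos j w) (bm_pos v w) - a| <= r]%SET.
have cB : #|B|%:R <= N%:R * (4 * (100 * (26 * r) ^+ 2) * n%:R).
  rewrite -{1}(card_ord N).
  apply: (@card_cover_le _ _ _ B (fun k => hits [set: 'I_n]%SET (grid_point (f k)) (26 * r) w)) => //.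
  move=> j; rewrite inE => /(cov _ _ (sphere_pos j w))[k jk]; exists k.
  rewrite hitE//; have := angle_triangle (sphere_pos j w) (sqs k) (sg (f k)).
  have := hf k; clear - jk aN nr r0; lra.
have cutA : (Defs.cut (final_graph w) A)%:R <= m%:R * #|B|%:R :> R.
  rewrite -natrM ler_nat; apply: cut_le_annulus => //.
  by move=> j; exact: sphere_pos.
(* A common lower bound for the sizes of A and of its complement, as a <= 1. *)
set D := (a / 1600) ^+ 2 * n%:R / 4.
have a0 : 0 < a by exact: lt_le_trans ra.
have an0 : 0 < a ^+ 2 * n%:R by rewrite mulr_gt0// exprn_gt0.
have D0 : 0 < D by rewrite /D; clear - an0; lra.
have DA : D <= #|A|%:R.
  by apply: le_trans A1; rewrite /D; clear - an0; lra.
have DC : D <= #|(~: A)%SET|%:R.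
  apply: le_trans A3; have : a ^+ 2 * n%:R <= 1 * n%:R.
    by rewrite ler_wpM2r// expr_le1// ltW.
  by rewrite /D; clear; lra.
have volB (S : {set 'I_n}) : D <= #|S|%:R -> m%:R * D <= (vol (final_graph w) S)%:R.
  move=> DS; apply: le_trans (_ : m%:R * #|S|%:R <= _); first by rewrite ler_wpM2l.
  by rewrite -natrM ler_nat; exact: vol_ge.
have mR : 0 < m%:R :> R by rewrite ltr0n.
have mD : 0 < m%:R * D by rewrite mulr_gt0.
rewrite /conductance.
set V := minn _ _.
have VD : m%:R * D <= V%:R by rewrite /V; case: leqP => _; exact: volB.
rewrite ler_pdivrMr; last exact: lt_le_trans VD.
apply: le_trans cutA _; apply: le_trans (_ : m%:R * (sparsity R * (r / a) * D) <= _).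
  rewrite ler_wpM2l//; apply: (le_trans cB).
  apply: le_trans (_ : 2 * (a / r) * (400 * 26 ^+ 2 * (r ^+ 2 * n%:R)) <= _).
    rewrite (_ : 4 * (100 * (26 * r) ^+ 2) * n%:R = 400 * 26 ^+ 2 * (r ^+ 2 * n%:R)); last by ring.
    have : 0 <= r ^+ 2 * n%:R by rewrite mulr_ge0// sqr_ge0.
    by move=> rn; apply: ler_wpM2r NR; clear - rn; lra.
  rewrite le_eqVlt; apply/orP; left; apply/eqP; rewrite /sparsity /D; field.
  by rewrite !gt_eqF.
rewrite mulrCA ler_wpM2l// mulr_ge0//; last by rewrite divr_ge0// ltW.
by rewrite /sparsity; clear; lra.
Qed.

Lemma large_balls (R : realType) (n m : nat) (r delta a : R)
    (M : base_model n m r delta) :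
  0 < delta -> (1 < n)%N -> (0 < m)%N -> 0 < r -> 26 * r <= 1 -> r <= a <= 1 -> 100 / n%:R <= r / 2 ->
  exists Bad : set (bm_space M), [/\ measurable Bad,
    prob (bm_prob M) Bad <= n%:R * expR (- n%:R) +
      4 * (n%:R ^+ 2 * expR (- ((r / 1600) ^+ 2 * n%:R / 4))) &
    forall w, ~ Bad w -> forall v, let A := neighborhood a v w in
      [/\ (a / 800) ^+ 2 * n%:R / 4 <= #|A|%:R,
          #|A|%:R <= 1600 * a ^+ 2 * n%:R &
          conductance R (final_graph w) A <= sparsity R * (r / a)]].
Proof.
move=> delta_gt0 n_gt1 m_gt0 r0 r1 ra1 nr; pose j0 : 'I_n := Ordinal (ltnW n_gt1); have /andP[ra a1] := ra1.
have nR : 0 < n%:R :> R by rewrite ltr0n ltnW.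
set e := (r / 1600) ^+ 2 * n%:R / 4.
(* All four occupancy bounds are weakened to the one exponent e, of order r^2 n. *)
have lebound (c x y : R) : r / 1600 <= x -> (r / 1600) ^+ 2 * n%:R <= x ^+ 2 * n%:R ->
    (x ^+ 2 * n%:R / 4 <= y) -> c <= n%:R ^+ 2 * expR (- y) -> c <= n%:R ^+ 2 * expR (- e).
  move=> _ xy h hc; apply: (le_trans hc); rewrite ler_wpM2l ?exprn_ge0//.
  by rewrite ler_expR lerN2; apply: le_trans h; rewrite /e ler_pM2r.
have sq (x : R) : r / 1600 <= x -> (r / 1600) ^+ 2 * n%:R <= x ^+ 2 * n%:R.
  move=> xr; rewrite ler_pM2r//; clear - xr r0; have r' : 0 <= r / 1600 by lra.
  by apply: lerXn2r; rewrite ?nnegrE ?(le_trans r').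
have cT : #|[set: 'I_n]%SET| = n by rewrite cardsT card_ord.
have [x1 x2 [x3 x4]] : [/\ 0 <= a / 2 <= 1, 0 <= (1 / 4 : R) <= 1 &
    0 <= 2 * a <= pi /\ 0 <= 26 * r <= pi].
  by have p2 := @pi_ge2 R; clear - p2 r0 r1 ra a1; split; [| |split]; lra.
have [y1 y2 y3 y4] : [/\ r / 1600 <= a / 2 / 400, r / 1600 <= 1 / 4 / 400,
  r / 1600 <= 2 * a & r / 1600 <= 26 * r] by clear - r0 r1 ra a1; split; lra.
have nn (x : R) : 0 <= x ^+ 2 * n%:R by rewrite mulr_ge0// sqr_ge0.
have [B0 [mB0 PB0 H0]] := edges_event M delta_gt0 n_gt1.
have [mB1 PB1] := grid_few M j0 [set: 'I_n]%SET x1.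
have [mB2 PB2] := grid_few M j0 [set: 'I_n]%SET x2.
have [mB3 PB3] := grid_many M j0 [set: 'I_n]%SET x3.
have [mB4 PB4] := grid_many M j0 [set: 'I_n]%SET x4.
rewrite cT in mB1 PB1 mB2 PB2 mB3 PB3 mB4 PB4.
move: mB1 PB1 mB2 PB2 mB3 PB3 mB4 PB4.
set B1 := [set w | _]; set B2 := [set w | _]; set B3 := [set w | _]; set B4 := [set w | _].
move=> mB1 PB1 mB2 PB2 mB3 PB3 mB4 PB4.
have {}PB1 := lebound _ _ _ y1 (sq _ y1) (lexx _) PB1.
have {}PB2 := lebound _ _ _ y2 (sq _ y2) (lexx _) PB2.
have {}PB3 : prob (bm_prob M) B3 <= n%:R ^+ 2 * expR (- e).
  by apply: (lebound _ _ _ y3 (sq _ y3) _ PB3); have := nn (2 * a); clear; lra.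
have {}PB4 : prob (bm_prob M) B4 <= n%:R ^+ 2 * expR (- e).
  by apply: (lebound _ _ _ y4 (sq _ y4) _ PB4); have := nn (26 * r); clear; lra.
exists (B0 `|` ((B1 `|` B2) `|` (B3 `|` B4))).
have mU12 := measurableU _ _ mB1 mB2; have mU34 := measurableU _ _ mB3 mB4.
have mU := measurableU _ _ mU12 mU34.
split; first exact: measurableU.
  apply: le_trans (prob_setU_le _ mB0 mU) _; rewrite lerD//.
  have U := prob_setU_le (bm_prob M) mU12 mU34.
  have U1 := prob_setU_le (bm_prob M) mB1 mB2.
  have U2 := prob_setU_le (bm_prob M) mB3 mB4.
  by clear - U U1 U2 PB1 PB2 PB3 PB4; lra.
move=> w nB v A.
have [nB0 nB1 nB2 nB3 nB4] : [/\ ~ B0 w, ~ B1 w, ~ B2 w, ~ B3 w & ~ B4 w].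
  by split => Bw; apply: nB; [left|right;left;left|right;left;right|
    right;right;left|right;right;right].
apply: large_ball_bounds => //.
- exact: H0.
- by move=> kl; rewrite leNgt; apply/negP => lt; apply: nB1; exists kl; exact: ltW.
- by move=> kl; rewrite leNgt; apply/negP => lt; apply: nB2; exists kl; exact: ltW.
- by move=> kl; rewrite leNgt; apply/negP => lt; apply: nB3; exists kl; exact: ltW.
- by move=> kl; rewrite leNgt; apply/negP => lt; apply: nB4; exists kl; exact: ltW.
Qed.

(** * Asymptotics *)

Section Asymptotics.
Context {R : realType}.
Implicit Types (a c x y : R).

Lemma powRD_gt0 y a b : 0 < y -> y `^ (a + b) = y `^ a * y `^ b.
Proof. by move=> y0; rewrite powRD// (gt_eqF y0) implybT. Qed.

Lemma near_le_powR a x : 0 < a -> \forall n \near \oo, x <= n%:R `^ a.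
Proof.
move=> a0; pose z := Num.max x 1; have z1 : 1 <= z by rewrite le_max lexx orbT.
exists (Num.truncn (z `^ a^-1)).+1 => // n /= hn.
have zn : z `^ a^-1 <= n%:R.
  by apply/ltW/(lt_le_trans (truncnS_gt _)); rewrite ler_nat.
apply: (@le_trans _ _ z); first by rewrite le_max lexx.
have an : a != 0 by rewrite gt_eqF.
have -> : z = (z `^ a^-1) `^ a by rewrite -powRrM mulVf// powRr1// (le_trans ler01).
by apply: (ge0_ler_powR (ltW a0)); rewrite ?nnegrE ?powR_ge0.
Qed.

(** One term x^p / p! of the exponential series, with a p >= 4, already outgrows n^4. *)
Lemma stretched_exp_small a c : 0 < a -> 0 < c ->
  exists C : R, forall n, (0 < n)%N ->
    n%:R ^+ 3 * expR (- (c * n%:R `^ a)) <= C / n%:R.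
Proof.
move=> a0 c0; pose p := (Num.truncn (4 / a)).+1.
have pa : 4 <= a * p%:R.
  by rewrite -ler_pdivrMl// mulrC ltW// truncnS_gt.
exists (p`!%:R / c ^+ p) => n n0.
have nR : 0 < n%:R :> R by rewrite ltr0n.
have n1 : 1 <= n%:R :> R by rewrite ler1n.
set x := c * _.
have x0 : 0 < x by rewrite mulr_gt0// powR_gt0.
have f0 : 0 < p`!%:R :> R by rewrite ltr0n fact_gt0.
have cp : 0 < c ^+ p by rewrite exprn_gt0.
have h : c ^+ p * n%:R ^+ 4 / p`!%:R <= expR x.
  apply: le_trans (_ : x ^+ p / p`!%:R <= _); last first.
    by apply: le_trans (expR_ge1Dxn (Num.truncn (4 / a)) (ltW x0)); rewrite lerDr.
  rewrite ler_pM2r ?invr_gt0// /x exprMn ler_pM2l//.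
  by rewrite -[leRHS]powR_mulrn ?powR_ge0// -powRrM -[leLHS]powR_mulrn ?ler0n// ler_powR.
rewrite expRN ler_pdivrMr ?expR_gt0//.
apply: le_trans (_ : p`!%:R / c ^+ p / n%:R * (c ^+ p * n%:R ^+ 4 / p`!%:R) <= _).
  by rewrite le_eqVlt; apply/orP; left; apply/eqP; field; rewrite !gt_eqF.
by rewrite ler_wpM2l// !divr_ge0// ltW.
Qed.

(** The source of the constant 16 / [rate R]: it makes the exponent rate m / 4 at least 4 ln n,
    which beats the n^3 pairs of grid point and vertex. *)
Lemma expRN_log_le x (n : nat) : (0 < n)%N -> 4 * ln n%:R <= x ->
  n%:R ^+ 3 * expR (- x) <= n%:R^-1.
Proof.
move=> n0 h; have nR : 0 < n%:R :> R by rewrite ltr0n.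
apply: (@le_trans _ _ (n%:R ^+ 3 * expR (- (4 * ln n%:R)))).
  by rewrite ler_wpM2l ?exprn_ge0// ler_expR lerN2.
have -> : expR (- (4 * ln n%:R)) = (n%:R ^+ 4)^-1 :> R.
  by rewrite expRN expRM_natl lnK.
by rewrite le_eqVlt; apply/orP; left; apply/eqP; field; rewrite gt_eqF.
Qed.

(** The witness is the complement of [Bad] for large n and the empty set for the remaining n, where
    nothing is known about [E n]. *)
Lemma whp_intro (m : nat -> nat) (r delta : nat -> R)
    (M : forall n, base_model n (m n) (r n) (delta n))
    (E : forall n, set (bm_space (M n))) (C : R) :
  (\forall n \near \oo, exists Bad : set (bm_space (M n)),
    [/\ measurable Bad, prob (bm_prob (M n)) Bad <= C / n%:R &
        forall w, ~ Bad w -> E n w]) -> whp E.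
Proof.
case=> N _ hN.
have hA n : exists A : set (bm_space (M n)),
    [/\ measurable A, A `<=` E n & (N <= n)%N -> 1 - C / n%:R <= prob (bm_prob (M n)) A].
  have [Nn|nN] := leqP N n; last by exists set0; split => //; rewrite leqNgt nN.
  have [Bad [mB PB HB]] := hN n Nn; exists (~` Bad); split.
  - exact: measurableC.
  - by move=> w nB; exact: HB.
  - by move=> _; rewrite prob_setC// lerD2l lerN2.
pose A n := projT1 (cid (hA n)).
have [mA AE PA] : [/\ forall n, measurable (A n), forall n, A n `<=` E n &
    forall n, (N <= n)%N -> 1 - C / n%:R <= prob (bm_prob (M n)) (A n)].
  by split=> n; rewrite /A; case: (cid (hA n)) => ? [].
exists A; split => //.
apply: cvg_EFin; first by apply: nearW => n; exact: fin_num_measure.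
apply/cvgrPdist_le => e e0; exists (maxn N (Num.truncn (C / e)).+1) => // n /=.
rewrite geq_max => /andP[Nn Cn].
have nR : 0 < n%:R :> R by rewrite ltr0n (leq_ltn_trans _ Cn).
have p1 : prob (bm_prob (M n)) (A n) <= 1.
  by rewrite -[leRHS]/(fine 1%:E) -(@probability_setT _ _ _ (bm_prob (M n))); apply: le_prob.
rewrite ger0_norm ?subr_ge0//.
have := PA n Nn; have : C / n%:R <= e.
  rewrite ler_pdivrMr// mulrC -ler_pdivrMr//; apply/ltW/(lt_le_trans (truncnS_gt _)).
  by rewrite ler_nat.
by rewrite -[fine _]/(prob (bm_prob (M n)) (A n)); lra.
Qed.

End Asymptotics.

(** * The two statements with high probability *)

Lemma large_balls_whp (R : realType) (xi eps rho : R) : 0 < xi -> 0 < eps ->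
  eps < rho -> rho <= 1 / 2 ->
  forall (m : nat -> nat)
    (G : forall n, base_model n (m n) (n%:R `^ (eps - 1 / 2)) (xi * (m n)%:R)),
  (forall n, 0 < m n)%N ->
  whp (fun n => [set w : bm_space (G n) | forall v : 'I_n,
    let A := neighborhood (n%:R `^ (rho - 1 / 2)) v w in
    (1 / 800) ^+ 2 / 4 * n%:R `^ (2 * rho) <= #|A|%:R <= 1600 * n%:R `^ (2 * rho) /\
    conductance R (final_graph w) A <= sparsity R * (1 / n%:R `^ (rho - eps))]).
Proof.
move=> xi0 eps0 er rho2 m G m0.
have [C1 hC1] := @stretched_exp_small R 1 1 ltr01 ltr01.
have c0 : 0 < (1 / 1600) ^+ 2 / 4 :> R by lra.
have [C2 hC2] := @stretched_exp_small R (2 * eps) _ (ltac:(lra) : 0 < 2 * eps) c0.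
apply: (@whp_intro _ _ _ _ _ _ (C1 + 4 * C2)).
(* The exponent is positive because eps < rho <= 1/2; this yields 26 r <= 1 for large n. *)
have near1 := @near_le_powR R (1 / 2 - eps) 26 ltac:(lra).
have near2 := @near_le_powR R (eps + 1 / 2) 200 ltac:(lra).
near=> n.
have n1 : (1 < n)%N by near: n; exists 2%N.
have nR : 0 < n%:R :> R by rewrite ltr0n ltnW.
have nR1 : 1 <= n%:R :> R by rewrite ler1n ltnW.
have d0 : 0 < xi * (m n)%:R by rewrite mulr_gt0// ltr0n.
set r := n%:R `^ (eps - 1 / 2); set a := n%:R `^ (rho - 1 / 2).
have r0 : 0 < r by rewrite powR_gt0.
have a0 : 0 < a by rewrite powR_gt0.
have r1 : 26 * r <= 1.
  have : 26 * r <= n%:R `^ (1 / 2 - eps) * r by rewrite ler_pM2r//; near: n.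
  rewrite /r -powRD_gt0//.
  by rewrite (_ : 1 / 2 - eps + (eps - 1 / 2) = 0) ?powRr0//; lra.
have ra : r <= a <= 1.
  rewrite ler_powR//=; last by lra.
  by rewrite -[leRHS](powRr0 n%:R) ler_powR//; lra.
have nr : 100 / n%:R <= r / 2.
  rewrite ler_pdivrMr// mulrAC ler_pdivlMr//.
  have -> : r * n%:R = n%:R `^ (eps + 1 / 2).
    rewrite /r -{2}(powRr1 (ltW nR)) -powRD_gt0//.
    by congr (_ `^ _); lra.
  apply: le_trans (_ : 200 <= _); first by lra.
  by near: n.
have sq (x : R) : (n%:R `^ (x - 1 / 2)) ^+ 2 * n%:R = n%:R `^ (2 * x).
  rewrite expr2 -powRD_gt0// -[X in _ * X = _](powRr1 (ltW nR)) -powRD_gt0//.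
  by congr (_ `^ _); lra.
have [Bad [mB PB HB]] := large_balls (G n) d0 n1 (m0 n) r0 r1 ra nr.
exists Bad; split => //.
  apply: (le_trans PB); rewrite [leRHS]mulrDl; apply: lerD.
    have := hC1 n (ltnW n1); rewrite powRr1 ?ler0n// mul1r; apply: le_trans.
    rewrite ler_wpM2r ?expR_ge0// -[leLHS]expr1; exact: ler_weXn2l.
  rewrite -[leRHS]mulrA ler_pM2l//; have := hC2 n (ltnW n1); apply: le_trans.
  rewrite (_ : (r / 1600) ^+ 2 * n%:R / 4 = (1 / 1600) ^+ 2 / 4 * n%:R `^ (2 * eps)); last first.
    by rewrite -sq -/r; lra.
  by rewrite ler_wpM2r ?expR_ge0//; apply: ler_weXn2l.
move=> w nB v; have [h1 h2 h3] := HB w nB v; split.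
  apply/andP; split.
    by apply: le_trans h1; rewrite -sq -/a; lra.
  by apply: (le_trans h2); rewrite -sq -/a; lra.
apply: (le_trans h3); rewrite le_eqVlt; apply/orP; left; apply/eqP; congr (_ * _).
have ra' : r = a * n%:R `^ (eps - rho) by rewrite /r /a -powRD_gt0//; congr (_ `^ _); lra.
by rewrite -/r ra' mulrAC divff ?gt_eqF// !mul1r -powRN opprB.
Unshelve. all: by end_near. Qed.

Lemma small_balls_whp (R : realType) (xi eps : R) : 0 < xi -> 0 < eps ->
  let r (n : nat) : R := n%:R `^ (eps - 1 / 2) in
  forall (m : nat -> nat)
    (G : forall n, base_model n (m n) (r n) (xi * (m n)%:R)),
  (forall n, 0 < m n)%N -> (forall n, 16 / rate R * ln n%:R <= (m n)%:R) ->
  forall RRmax : nat -> R, RRmax =o_\oo r ->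
  whp (fun n => [set w : bm_space (G n) |
    forall RR : R, 0 <= RR <= RRmax n -> forall v : 'I_n,
    let A := neighborhood RR v w in
    A != [set: 'I_n]%SET -> (1 + 16 / rate R)^-1 <= conductance R (final_graph w) A]).
Proof.
move=> xi0 eps0 r m G m0 mK RRmax /eqoP small.
have rt0 := rate_gt0 R.
have nm n : (0 < n)%N -> n%:R ^+ 3 * expR (- (rate R * (m n)%:R / 4)) <= n%:R^-1.
  move=> n0; apply: expRN_log_le => //.
  have := ler_wpM2l (ltW rt0) (mK n); rewrite mulrA mulrCA divff ?gt_eqF// mulr1.
  by lra.
have [C1 hC1] := @stretched_exp_small R 1 1 ltr01 ltr01.
have near_n := @near_le_powR R 1 (100 * 100) ltr01.
(* For eps <= 1/2 the reach r is at most 1; for eps > 1/2 it tends to infinity and eventually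
   exceeds 4 > pi, so that all pairs of points are within reach. *)
have [e2|e2] := leP eps (1 / 2).
- have c0 : 0 < (1 / 100 / 400) ^+ 2 / 16 :> R by lra.
  have e0 : 0 < 2 * eps by lra.
  have [C2 hC2] := @stretched_exp_small R (2 * eps) _ e0 c0.
  have [C3 hC3] := @stretched_exp_small R (2 * eps) (100 * 3 ^+ 2) e0 ltac:(lra).
  apply: (@whp_intro _ _ _ _ _ _ (C1 + 2 * C2 + 2 * 1 + C3)).
  have near1 := @near_le_powR R (eps + 1 / 2) (100 * 100) ltac:(lra).
  (* The little-o is used once, at the ratio 1/100 allowed by [expansion_small]; the resulting good
     event serves all radii up to [RRmax n]. *)
  have near2 := small (1 / 100) ltac:(lra).
  near=> n.
  have n1 : (1 < n)%N by near: n; exists 2%N.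
  have nR : 0 < n%:R :> R by rewrite ltr0n ltnW.
  have nR1 : 1 <= n%:R :> R by rewrite ler1n ltnW.
  have d0 : 0 < xi * (m n)%:R by rewrite mulr_gt0// ltr0n.
  have r0 : 0 < r n by rewrite powR_gt0.
  have r01 : 0 < r n <= 1.
    by rewrite r0/= /r -[leRHS](powRr0 n%:R) ler_powR//; lra.
  have sq : r n ^+ 2 * n%:R = n%:R `^ (2 * eps).
    rewrite expr2 -powRD_gt0// -[X in _ * X = _](powRr1 (ltW nR)) -powRD_gt0//.
    by congr (_ `^ _); lra.
  have rn : 1 <= r n ^+ 2 * n%:R.
    by rewrite sq -[leLHS](powRr0 n%:R) ler_powR//; lra.
  have nr : 100 / n%:R <= r n / 100.
    rewrite ler_pdivrMr// mulrAC ler_pdivlMr//.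
    have -> : r n * n%:R = n%:R `^ (eps + 1 / 2).
      rewrite /r -{2}(powRr1 (ltW nR)) -powRD_gt0//.
      by congr (_ `^ _); lra.
    by near: n.
  have RRr : `|RRmax n| <= 1 / 100 * `|r n| by near: n.
  have [Bad [mB PB HB]] := expansion_small (G n) d0 n1 (m0 n) r01 rn nr.
  have n23 : n%:R ^+ 2 <= n%:R ^+ 3 :> R by apply: ler_weXn2l.
  exists Bad; split => //.
    apply: (le_trans PB).
    rewrite (_ : (C1 + 2 * C2 + 2 * 1 + C3) / n%:R =
      C1 / n%:R + 2 * (C2 / n%:R) + 2 * n%:R^-1 + C3 / n%:R); last by ring.
    apply: lerD; first apply: lerD; first apply: lerD.
    + have := hC1 n (ltnW n1); rewrite powRr1 ?ler0n// mul1r; apply: le_trans.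
      rewrite ler_wpM2r ?expR_ge0// -[leLHS]expr1; exact: ler_weXn2l.
    + rewrite ler_pM2l//; have := hC2 n (ltnW n1); apply: le_trans.
      rewrite (_ : (r n / 100 / 400) ^+ 2 * n%:R / 16 =
        (1 / 100 / 400) ^+ 2 / 16 * n%:R `^ (2 * eps)); last by rewrite -sq; lra.
      by rewrite ler_wpM2r ?expR_ge0.
    + by rewrite ler_pM2l//; exact: nm (ltnW n1).
    + have := hC3 n (ltnW n1); apply: le_trans.
      rewrite (_ : 100 * (3 * r n) ^+ 2 * n%:R = 100 * 3 ^+ 2 * n%:R `^ (2 * eps)); last first.
        by rewrite -sq; ring.
      by rewrite ler_wpM2r ?expR_ge0.
  move=> w nB RR /andP[RR0 RR1] v AT; apply: HB => //; rewrite RR0/=.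
  apply: (le_trans RR1); apply: le_trans (ler_norm _) _; apply: (le_trans RRr).
  by rewrite gtr0_norm//; lra.
- have c0 : 0 < (1 / 100 / 400) ^+ 2 / 16 :> R by lra.
  have [C2 hC2] := @stretched_exp_small R 1 _ ltr01 c0.
  apply: (@whp_intro _ _ _ _ _ _ (C1 + 2 * C2 + 2 * 1)).
  have near1 := @near_le_powR R (eps - 1 / 2) 4 ltac:(lra).
  near=> n.
  have n1 : (1 < n)%N by near: n; exists 2%N.
  have nR : 0 < n%:R :> R by rewrite ltr0n ltnW.
  have nR1 : 1 <= n%:R :> R by rewrite ler1n ltnW.
  have d0 : 0 < xi * (m n)%:R by rewrite mulr_gt0// ltr0n.
  have r4 : 4 <= r n by near: n.
  have nr : 100 / n%:R <= 1 / 100 :> R.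
    rewrite ler_pdivrMr// mulrAC ler_pdivlMr// mul1r -[leRHS](powRr1 (ltW nR)).
    by near: n.
  have [Bad [mB PB HB]] := expansion_large (G n) d0 n1 (m0 n) r4 nr.
  have n23 : n%:R ^+ 2 <= n%:R ^+ 3 :> R by apply: ler_weXn2l.
  exists Bad; split => //.
    apply: (le_trans PB).
    rewrite (_ : (C1 + 2 * C2 + 2 * 1) / n%:R =
      C1 / n%:R + 2 * (C2 / n%:R) + 2 * n%:R^-1); last by ring.
    apply: lerD; first apply: lerD.
    + have := hC1 n (ltnW n1); rewrite powRr1 ?ler0n// mul1r; apply: le_trans.
      rewrite ler_wpM2r ?expR_ge0// -[leLHS]expr1; exact: ler_weXn2l.
    + rewrite ler_pM2l//; have := hC2 n (ltnW n1); apply: le_trans.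
      rewrite powRr1 ?ler0n// (_ : (1 / 100 / 400) ^+ 2 * n%:R / 16 =
        (1 / 100 / 400) ^+ 2 / 16 * n%:R); last by lra.
      by rewrite ler_wpM2r ?expR_ge0.
    + by rewrite ler_pM2l//; exact: nm (ltnW n1).
  by move=> w nB RR /andP[RR0 RR1] v AT; exact: HB.
Unshelve. all: by end_near. Qed.

Theorem theorem5 (R : realType) (xi eps : R) (xi_gt0 : 0 < xi)
    (eps_gt0 : 0 < eps) :
  let r (n : nat) : R := n%:R `^ (eps - 1 / 2) in
  exists2 K : R, 0 < K &
    (forall rho : R, eps < rho -> rho <= 1 / 2 ->
      let RR (n : nat) : R := n%:R `^ (rho - 1 / 2) in
      exists c1 c2 C : R, [/\ 0 < c1, 0 < c2, 0 < C &
        forall (m : nat -> nat)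
          (G : forall n, base_model n (m n) (r n) (xi * (m n)%:R)),
          (forall n, 0 < m n)%N -> (forall n, K * ln n%:R <= (m n)%:R) ->
          whp (fun n => [set w : bm_space (G n) | forall v : 'I_n,
            let A := neighborhood (RR n) v w in
            c1 * n%:R `^ (2 * rho) <= #|A|%:R <= c2 * n%:R `^ (2 * rho) /\
            conductance R (final_graph w) A <= C * (1 / n%:R `^ (rho - eps))])])
    /\
    (exists2 c : R, 0 < c &
      forall (m : nat -> nat)
        (G : forall n, base_model n (m n) (r n) (xi * (m n)%:R)),
        (forall n, 0 < m n)%N -> (forall n, K * ln n%:R <= (m n)%:R) ->
        forall RRmax : nat -> R, RRmax =o_\oo r ->
        whp (fun n => [set w : bm_space (G n) |
          forall RR : R, 0 <= RR <= RRmax n -> forall v : 'I_n,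
          let A := neighborhood RR v w in
          A != [set: 'I_n]%SET -> c <= conductance R (final_graph w) A])).
Proof.
have rt0 := rate_gt0 R; have rt16 : 0 < 16 / rate R by rewrite divr_gt0.
move=> r; exists (16 / rate R) => //; split.
  move=> rho er rho2 RR; exists ((1 / 800) ^+ 2 / 4), 1600, (sparsity R).
  split; [lra|lra|by rewrite /sparsity; lra|].
  by move=> m G m0 _; exact: large_balls_whp.
exists (1 + 16 / rate R)^-1; first by rewrite invr_gt0 addr_gt0.
by move=> m G m0 mK RRmax small; exact: small_balls_whp.
Qed.
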